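(* As elements of the shifted Berenstein--Kirillov group $\mathcal{SBK}$, with $\mathsf q_0:=1$, $$\mathsf t_1=\mathsf q_1,\qquad \mathsf t_i=\mathsf q_{i-1}\mathsf q_i\mathsf q_{i-1}\mathsf q_{i-2}\quad\text{for } i\ge2.$$ Consequently, the elements $\mathsf q_1,\dots,\mathsf q_{n-1}$ are generators of $\mathcal{SBK}_n$.
   Context: **Shifted tableaux.** A strict partition $\lambda=(\lambda_1>\dots>\lambda_k>0)$ is identified with its shifted shape, the set of boxes $(r,c)$ (row $r$, column $c$, rows numbered downwards) with $1\le r\le k$, $r\le c\le r+\lambda_r-1$; boxes $(r,r)$ form the main diagonal. For strict partitions $\mu\subseteq\lambda$, $\lambda/\mu$ is the skew shifted shape obtained by removing the boxes of $\mu$ from those of $\lambda$; it is straight if $\mu=\emptyset$. Let $[n]'=\{1'<1<\dots<n'<n\}$; bold $\mathbf i$ denotes a letter that is either $i$ or $i'$. A shifted semistandard tableau of shape $\lambda/\mu$ is a filling by letters of $[n]'$, weakly increasing along rows (left to right) and columns (top to bottom), with at most one $i$ per column and at most one $i'$ per row for each $i$. The reading word is obtained by concatenating the rows from bottom to top, each read left to right. A filling is in canonical form if, for each $i$, the first letter among $i,i'$ in its reading word is unprimed; the canonical form of a filling is obtained by unpriming those first letters, and fillings with the same canonical form are identified. $\mathsf{ShST}(\lambda/\mu,n)$ is the set of shifted semistandard tableaux of shape $\lambda/\mu$ on $[n]'$ in canonical form. $T^i$ is the part of $T$ filled with $i,i'$. A tableau $B$ extends a tableau $A$ if their shapes are $\lambda/\mu$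 and $\mu/\nu$ for some strict partitions $\nu\subseteq\mu\subseteq\lambda$. $A\sqcup B$ denotes the union of the two fillings. **Shifted switching process.** Let $A$ be filled with $a,a'$ and $B$ with $b,b'$, with $B$ extending $A$. In $A\sqcup B$ one performs switches (letters keep their priming unless stated otherwise; diagonal switches (S3), (S4), (S7) take precedence over the others): (S1) an $\mathbf a$-box whose only adjacent $\mathbf b$-box (to its right or below) is to its right is swapped with it; (S2) the same with the only adjacent $\mathbf b$-box below; (S3) $(r,r)=\mathbf a$, $(r,r+1)=b'$, $(r+1,r+1)=\mathbf b$ becomes $(r,r)=\mathbf b$, $(r,r+1)=b$, $(r+1,r+1)=\mathbf a$; (S4) $(r,r)=\mathbf a$, $(r,r+1)=a$, $(r+1,r+1)=\mathbf b$, where $\mathbf b$ is the only $\mathbf b$-box adjacent to $(r,r+1)$, becomes $(r,r)=\mathbf b$, $(r,r+1)=a'$, $(r+1,r+1)=\mathbf a$; (S5) an $\mathbf a$-box with $b'$ to its right and $\mathbf b$ below is swapped with the $b'$ to its right; (S6) an $\mathbf a$-box with unprimed $b$ to its right and $\mathbf b$ below is swapped with the $\mathbf b$ below; (S7) $(r,r)=\mathbf a$, $(r,r+1)=a$, $(r,r+2)=b$, $(r+1,r+1)=\mathbf b$ becomes $(r,r)=\mathbf b$, $(r,r+1)=a'$, $(r,r+2)=b$, $(r+1,r+1)=\mathbf a$. Repeatedly choose the rightmost unprimed $a$-box having a $\mathbf b$-box immediately to its right or below, or, if none exists, the bottommost $a'$-box with this property, and apply the applicable switch, until no $\mathbf a$-box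 has such a neighbour. Then $\mathsf{SP}_1(A,B)$ is the resulting $\mathbf b$-part and $\mathsf{SP}_2(A,B)$ the resulting $\mathbf a$-part. **Shifted Bender--Knuth involutions.** For $T\in\mathsf{ShST}(\lambda/\mu,n)$, $n>1$, and $1\le i\le n-1$, $\mathsf{SP}_{i,i+1}(T)$ is obtained from $T$ by replacing $T^i\sqcup T^{i+1}$ with $\mathsf{SP}_1(T^i,T^{i+1})\sqcup\mathsf{SP}_2(T^i,T^{i+1})$, and $\mathsf t_i(T):=\theta_i\,\mathsf{SP}_{i,i+1}(T)$, where $\theta_i$ interchanges the labels $i\leftrightarrow i+1$ and $i'\leftrightarrow (i+1)'$ (then canonicalizes). **Shifted Berenstein--Kirillov group.** $\mathcal{SBK}$ is the free group on $\mathsf t_i$, $i\ge1$, modulo the relations the operators $\mathsf t_i$ satisfy when acting on shifted semistandard tableaux of any shape $\lambda/\mu$. $\mathcal{SBK}_n$ is the subgroup generated by $\mathsf t_1,\dots,\mathsf t_{n-1}$. Put $\mathsf q_i:=\mathsf t_1(\mathsf t_2\mathsf t_1)\cdots(\mathsf t_i\mathsf t_{i-1}\cdots\mathsf t_1)$ for $i\ge1$. *)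

(* Defs.v *)
From HB Require Import structures.
From mathcomp Require Import all_boot.
From mathcomp Require Import boolp classical_sets.

Set Implicit Arguments.
Unset Strict Implicit.
Unset Printing Implicit Defensive.

(* Boxes are numbered from 0: the pair (r, c) is the box usually called
   (r+1, c+1).  Letters are numbered from 1. *)

Definition box := (nat * nat)%type.

Definition box_right (x : box) : box := (x.1, x.2.+1).
Definition box_below (x : box) : box := (x.1.+1, x.2).

Definition strict_partition (la : seq nat) : bool :=
  sorted gtn la && (0 \notin la).

Definition in_shape (la : seq nat) (x : box) : bool :=
  x.1 <= x.2 < x.1 + nth 0 la x.1.

Definition subshape (mu la : seq nat) : Prop :=
  forall x, in_shape mu x -> in_shape la x.

Definition in_skew (la mu : seq nat) (x : box) : bool :=
  in_shape la x && ~~ in_shape mu x.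

(* (i, false) is the letter i and (i, true) is the letter i'. *)
Definition letter := (nat * bool)%type.

Definition lel (l m : letter) : bool :=
  (l.1 < m.1) || (l.1 == m.1) && (m.2 ==> l.2).

(* The value is None outside the (skew) shape that is filled. *)
Definition filling := box -> option letter.

Definition has_letter (i : nat) (o : option letter) : bool :=
  if o is Some l then l.1 == i else false.

Definition reading_order (la : seq nat) : seq box :=
  flatten [seq [seq (r, c) | c <- iota r (nth 0 la r)]
          | r <- rev (iota 0 (size la))].

Definition reading_word (la : seq nat) (T : filling) : seq letter :=
  pmap T (reading_order la).

Definition canonical_form (la : seq nat) (T : filling) : Prop :=
  forall i,
    ohead [seq l <- reading_word la T | l.1 == i] != Some (i, true).

Definition first_box (la : seq nat) (T : filling) (i : nat) : option box :=
  ohead [seq x <- reading_order la | has_letter i (T x)].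

Definition canonicalize (la : seq nat) (T : filling) : filling := fun x =>
  if T x is Some (i, p) then Some (i, p && (first_box la T i != Some x))
  else None.

Record ShST (la mu : seq nat) (n : nat) (T : filling) : Prop := {
  ShST_shape : forall x, isSome (T x) = in_skew la mu x;
  ShST_letters : forall x l, T x = Some l -> 1 <= l.1 <= n;
  ShST_row : forall r c d l m, c <= d ->
    T (r, c) = Some l -> T (r, d) = Some m -> lel l m;
  ShST_col : forall r s c l m, r <= s ->
    T (r, c) = Some l -> T (s, c) = Some m -> lel l m;
  ShST_unprimed : forall r s c i,
    T (r, c) = Some (i, false) -> T (s, c) = Some (i, false) -> r = s;
  ShST_primed : forall r c d i,
    T (r, c) = Some (i, true) -> T (r, d) = Some (i, true) -> c = d;
  ShST_canonical : canonical_form la T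
}.

Definition part (T : filling) (i : nat) : filling := fun x =>
  if has_letter i (T x) then T x else None.

Definition union_filling (A B : filling) : filling := fun x =>
  if A x is Some l then Some l else B x.

Section Switching.

Variables (la : seq nat) (a b : nat).
Implicit Types (S : filling) (x y : box).

Definition swap_boxes S x y : filling := fun z =>
  if z == x then S y else if z == y then S x else S z.

Definition relabel S x (l : letter) : filling := fun z =>
  if z == x then Some l else S z.

Definition b_right S x := has_letter b (S (box_right x)).
Definition b_below S x := has_letter b (S (box_below x)).

(* Primes are carried along by the swaps: only the box off the main diagonal
   gets a new letter in (S3), (S4) and (S7).  For (S3) the chosen box is
   x = (r, r); for (S4) and (S7) it is x = (r, r+1), because (r, r) has no
   adjacent b-box there. *)

Definition S3_applies S x : bool :=
  let: (r, c) := x in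
  [&& c == r, S (r, r.+1) == Some (b, true)
    & has_letter b (S (r.+1, r.+1))].

Definition S3 S x : filling :=
  let: (r, _) := x in
  relabel (swap_boxes S (r, r) (r.+1, r.+1)) (r, r.+1) (b, false).

Definition S4_S7_pattern S x : bool :=
  let: (r, c) := x in
  [&& c == r.+1, S x == Some (a, false), has_letter a (S (r, r))
    & has_letter b (S (r.+1, r.+1))].

Definition S4_applies S x : bool := S4_S7_pattern S x && ~~ b_right S x.

Definition S7_applies S x : bool :=
  S4_S7_pattern S x && (S (box_right x) == Some (b, false)).

Definition S4_S7 S x : filling :=
  let: (r, _) := x in
  relabel (swap_boxes S (r, r) (r.+1, r.+1)) x (a, true).

Definition switch_at S x : filling :=
  if S3_applies S x then S3 S x
  else if S4_applies S x || S7_applies S x then S4_S7 S x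
  else if b_right S x then
    if b_below S x then
      if S (box_right x) == Some (b, true)
      then swap_boxes S x (box_right x)  (* S5 *)
      else swap_boxes S x (box_below x)  (* S6 *)
    else swap_boxes S x (box_right x)    (* S1 *)
  else swap_boxes S x (box_below x).     (* S2 *)

Definition candidates S (p : bool) (s : seq box) : seq box :=
  [seq x <- s | (S x == Some (a, p)) && (b_right S x || b_below S x)].

Definition rightmost_first : seq box :=
  sort (fun x y => y.2 <= x.2) (reading_order la).

Definition chosen_box S : option box :=
  if ohead (candidates S false rightmost_first) is Some x then Some x
  else ohead (candidates S true (reading_order la)).

Definition switch_step S : filling :=
  if chosen_box S is Some x then switch_at S x else S.

(* Each switch increases the sum of r + c over the a-boxes (r, c); as
   r + c < 2 |la|, this sum is less than 2 |la|^2 and the iteration below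
   always reaches a filling where no a-box can be chosen any more. *)
Definition switching (A B : filling) : filling :=
  iter (2 * sumn la ^ 2) switch_step (union_filling A B).

Definition SP1 (A B : filling) : filling := part (switching A B) b.
Definition SP2 (A B : filling) : filling := part (switching A B) a.

End Switching.

Definition SP (la : seq nat) (i : nat) (T : filling) : filling := fun x =>
  if has_letter i (T x) || has_letter i.+1 (T x)
  then let A := part T i in let B := part T i.+1 in
       union_filling (SP1 la i i.+1 A B) (SP2 la i i.+1 A B) x
  else T x.

Definition exchange_labels (i : nat) (T : filling) : filling := fun x =>
  if T x is Some (j, p) then
    Some (if j == i then i.+1 else if j == i.+1 then i else j, p)
  else None.

(* la is the outer shape of T; the inner shape is determined by T. *)
Definition BK (la : seq nat) (i : nat) (T : filling) : filling :=
  canonicalize la (exchange_labels i (SP la i T)).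

(* The free generators of SBK are indexed from 0: the generator k is t_(k+1).
   In an element of the free group, (k, false) stands for the generator k and
   (k, true) for its inverse.  A sequence of operators acts as their composite,
   the rightmost operator being applied first. *)

Definition BK_word (la : seq nat) (u : seq nat) (T : filling) : filling :=
  foldr (fun k => BK la k.+1) T u.

Definition BK_relation (u v : seq nat) : Prop :=
  forall (la mu : seq nat) (n : nat) (T : filling),
    strict_partition la -> strict_partition mu -> subshape mu la ->
    all (fun k => k.+1 < n) (u ++ v) ->
    ShST la mu n T ->
    BK_word la u T =1 BK_word la v T.

Definition word := seq (nat * bool).

Definition inv_word (w : word) : word := [seq (l.1, ~~ l.2) | l <- rev w].

Inductive SBK_eqv : word -> word -> Prop :=
| SBK_refl w : SBK_eqv w w
| SBK_sym w1 w2 : SBK_eqv w1 w2 -> SBK_eqv w2 w1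
| SBK_trans w1 w2 w3 : SBK_eqv w1 w2 -> SBK_eqv w2 w3 -> SBK_eqv w1 w3
| SBK_cat w1 w2 v1 v2 :
    SBK_eqv w1 w2 -> SBK_eqv v1 v2 -> SBK_eqv (w1 ++ v1) (w2 ++ v2)
| SBK_cancel k e : SBK_eqv [:: (k, e); (k, ~~ e)] [::]
| SBK_relation u v : BK_relation u v ->
    SBK_eqv [seq (k, false) | k <- u] [seq (k, false) | k <- v].

Definition SBK_rel : rel word := fun w1 w2 => `[< SBK_eqv w1 w2 >].

Lemma SBK_rel_refl : reflexive SBK_rel.
Proof. by move=> w; apply/asboolP/SBK_refl. Qed.

Lemma SBK_rel_sym : symmetric SBK_rel.
Proof. by move=> v w; apply/asboolP/asboolP => /SBK_sym. Qed.

Lemma SBK_rel_trans : transitive SBK_rel.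
Proof.
move=> w v u /asboolP h1 /asboolP h2; apply/asboolP; exact: SBK_trans h1 h2.
Qed.

Canonical SBK_equiv := EquivRel SBK_rel SBK_rel_refl SBK_rel_sym SBK_rel_trans.

Definition SBK := {eq_quot SBK_equiv}%qT.

HB.instance Definition _ := Choice.on SBK.
HB.instance Definition _ := EqQuotient.on SBK.

Section SBKGroup.
Local Open Scope quotient_scope.

Lemma SBK_piP (v w : word) : SBK_eqv v w <-> \pi_SBK v = \pi_SBK w.
Proof.
split=> [h|h]; first by apply/eqmodP/asboolP.
by apply/asboolP; move/eqmodP: h.
Qed.

Lemma SBK_reprK (w : word) : SBK_eqv (repr (\pi_SBK w)) w.
Proof. by apply/SBK_piP; rewrite reprK. Qed.

Lemma inv_word_cat v w : inv_word (v ++ w) = inv_word w ++ inv_word v.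
Proof. by rewrite /inv_word rev_cat map_cat. Qed.

Lemma inv_wordK : involutive inv_word.
Proof.
move=> w; rewrite /inv_word -map_rev revK -map_comp map_id_in // => -[k e] _.
by rewrite /= negbK.
Qed.

Lemma SBK_mulVw w : SBK_eqv (inv_word w ++ w) [::].
Proof.
elim: w => [|[k e] w IH]; first exact: SBK_refl.
rewrite -cat1s inv_word_cat -catA (catA _ [:: (k, e)]).
apply: SBK_trans IH; apply: SBK_cat; first exact: SBK_refl.
rewrite -[X in SBK_eqv _ X]cat0s; apply: SBK_cat; last exact: SBK_refl.
by have := SBK_cancel k (~~ e); rewrite negbK.
Qed.

Lemma SBK_mulwV w : SBK_eqv (w ++ inv_word w) [::].
Proof. by rewrite -{1}[w]inv_wordK; apply: SBK_mulVw. Qed.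

Lemma SBK_inv v w : SBK_eqv v w -> SBK_eqv (inv_word v) (inv_word w).
Proof.
move=> h.
apply: (@SBK_trans _ (inv_word v ++ (w ++ inv_word w))).
  rewrite -[X in SBK_eqv X _]cats0; apply: SBK_cat; first exact: SBK_refl.
  exact/SBK_sym/SBK_mulwV.
rewrite catA -[X in SBK_eqv _ X]cat0s; apply: SBK_cat; last exact: SBK_refl.
apply: SBK_trans (SBK_mulVw v); apply: SBK_cat; first exact: SBK_refl.
exact: SBK_sym.
Qed.

Definition SBK_one : SBK := \pi_SBK [::].
Definition SBK_mul (x y : SBK) : SBK := \pi_SBK (repr x ++ repr y).
Definition SBK_invg (x : SBK) : SBK := \pi_SBK (inv_word (repr x)).

Lemma SBK_mulA : associative SBK_mul.
Proof.
move=> x y z; apply/SBK_piP.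
apply: (@SBK_trans _ (repr x ++ (repr y ++ repr z))).
  by apply: SBK_cat; [exact: SBK_refl | exact: SBK_reprK].
rewrite catA; apply: SBK_cat; last exact: SBK_refl.
exact/SBK_sym/SBK_reprK.
Qed.

Lemma SBK_mul1 : left_id SBK_one SBK_mul.
Proof.
move=> x; rewrite -[RHS]reprK; apply/SBK_piP.
rewrite -[X in SBK_eqv _ X]cat0s.
by apply: SBK_cat; [exact: SBK_reprK | exact: SBK_refl].
Qed.

Lemma SBK_mulr1 : right_id SBK_one SBK_mul.
Proof.
move=> x; rewrite -[RHS]reprK; apply/SBK_piP.
rewrite -[X in SBK_eqv _ X]cats0.
by apply: SBK_cat; [exact: SBK_refl | exact: SBK_reprK].
Qed.

Lemma SBK_mulV : left_inverse SBK_one SBK_invg SBK_mul.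
Proof.
move=> x; apply/SBK_piP; apply: SBK_trans (SBK_mulVw (repr x)).
by apply: SBK_cat; [exact: SBK_reprK | exact: SBK_refl].
Qed.

Lemma SBK_mulrV : right_inverse SBK_one SBK_invg SBK_mul.
Proof.
move=> x; apply/SBK_piP; apply: SBK_trans (SBK_mulwV (repr x)).
by apply: SBK_cat; [exact: SBK_refl | exact: SBK_reprK].
Qed.

End SBKGroup.

HB.instance Definition _ := isGroup.Build SBK
  SBK_mulA SBK_mul1 SBK_mulr1 SBK_mulV SBK_mulrV.

Local Open Scope group_scope.
Local Open Scope classical_set_scope.

(* t_ i is meaningful for i >= 1 only; t_ 0 is set to 1. *)
Definition t_ (i : nat) : SBK :=
  if i is k.+1 then (\pi_SBK [:: (k, false)])%qT else 1.

(* descent i = t_i t_(i-1) ... t_1 *)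
Fixpoint descent (i : nat) : SBK :=
  if i is j.+1 then t_ j.+1 * descent j else 1.

Fixpoint q_ (i : nat) : SBK :=
  if i is j.+1 then q_ j * descent j.+1 else 1.

Definition generated (G : groupType) (A : set G) : set G :=
  smallest (fun H : set G => group_closed [in H]) A.

Definition SBK_sub (n : nat) : set SBK :=
  generated [set t_ i | i in [set i : nat | 1 <= i < n]%N].

(* Main.v *)
Require Import Defs.
From mathcomp Require Import all_boot zify.
From mathcomp Require Import boolp classical_sets.

(** The relations between the [t_ i] and the [q_ i] are formal consequences of
    two facts: the [t_ i] are involutions, and [t_ i], [t_ j] commute when
    [i] and [j] differ by at least 2.  Indeed the commutations give
    [q_ i = (descent i)^-1 * q_ i.-1] ([q_rev]), whence [q_ i] is an involution
    ([q_invol]) and the product [q_ i.-1 * q_ i * q_ i.-1 * q_ i.-2] collapses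
    to [t_ i] ([t_q]).  Operators with distant indices act on disjoint sets of
    boxes ([BK_commute]); the substance is that switching two adjacent strips
    of a tableau is an involution ([BK_involutive]).

    The idea is to forget rows and columns.  Call [c - r] the content of the
    box [(r, c)].  At any time at most one box can be added to a shape on a
    given diagonal, so growing a shape box by box is writing a word of contents
    ([valid]), and a filling is drawn by a word of labelled contents
    ([filled]).  The boxes labelled [i] or [i'] meet each diagonal at most
    once.  Listing the primed ones from top to bottom and then the unprimed
    ones from left to right gives a word that first decreases and then
    increases ([vee]), and in canonical form the primes are a function of this
    word: a letter is primed if and only if the next content is smaller
    ([labelled]).  So the letters [i] and [i.+1] of a tableau are just a pair
    of such words ([ShST_two_strips]).

    In this encoding a box [a] that slides through boxes [b] is a letter
    moving to the right through a word.  Consecutive letters with different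
    contents may be exchanged without altering the filling ([filled_comm]);
    exchanging the labels of two consecutive letters with neighbouring
    contents is a swap of adjacent boxes ([filled_swap]).  Hence sliding all
    the boxes of a strip through another strip is the map [infuse], a grid of
    crossings.  Each crossing can be undone by crossing back, and reading the
    grid by columns instead of rows shows that [infuse] is its own inverse
    ([infuseK]).

    It remains to see that the switching process computes [infuse]
    ([switching_word]).  The process always treats the last unfinished letter
    of the word of [a]; the rules (S1), (S2), (S5) and (S6) are crossings.
    Contents move by steps of one and never meet, so relative orders, hence
    canonical primes, persist; the exception is the word 0 1 0 on the main
    diagonal, where no lower content separates the two boxes of content 0.
    Rule (S3) is that word with one [a] and two [b], rules (S4) and (S7) are
    that word with two [a] and one [b], and their relabelling is the one that
    restores the canonical primes. *)

Set Implicit Arguments.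
Unset Strict Implicit.
Unset Printing Implicit Defensive.

(** * Words of contents *)

(** A shape is encoded by the function sending a diagonal [d] to the row
    [h d] of its first free box. *)
Definition grow (h : nat -> nat) (d : nat) : nat -> nat :=
  fun e => h e + (e == d).

Definition grown (h : nat -> nat) (w : seq nat) : nat -> nat := foldl grow h w.

(** The left neighbour and the upper neighbour of the new box lie on the
    diagonals [d.-1] and [d.+1]; the main diagonal has no left neighbour. *)
Definition addable (h : nat -> nat) (d : nat) : bool :=
  ((d == 0) || (h d.-1 == (h d).+1)) && (h d.+1 == h d).

Fixpoint valid (h : nat -> nat) (w : seq nat) : bool :=
  if w is d :: w' then addable h d && valid (grow h d) w' else true.

Definition cnt (e : nat) (w : seq nat) : nat := count_mem e w.

Lemma cnt0 e w : e \notin w -> cnt e w = 0.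
Proof. by move/count_memPn. Qed.

Lemma cnt_cat e w1 w2 : cnt e (w1 ++ w2) = cnt e w1 + cnt e w2.
Proof. exact: count_cat. Qed.

Lemma cnt_cons e d w : cnt e (d :: w) = (d == e) + cnt e w.
Proof. by []. Qed.

Lemma grownE h w e : grown h w e = h e + cnt e w.
Proof.
elim: w h => [|d w IH] h /=; first by rewrite addn0.
by rewrite IH /grow -addnA eq_sym.
Qed.

Lemma grown_cat h w1 w2 : grown h (w1 ++ w2) = grown (grown h w1) w2.
Proof. by rewrite /grown foldl_cat. Qed.

Lemma growC h d e : grow (grow h d) e = grow (grow h e) d.
Proof. by apply: funext => x; rewrite /grow addnAC. Qed.

Lemma valid_cat h w1 w2 :
  valid h (w1 ++ w2) = valid h w1 && valid (grown h w1) w2.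
Proof. by elim: w1 h => //= d w1 IH h; rewrite IH andbA. Qed.

Definition adj (x y : nat) : bool := (x == y.+1) || (y == x.+1).

Lemma adjP x y : adj x y -> x = y.+1 \/ y = x.+1.
Proof. by case/orP=> /eqP; [left | right]. Qed.

Lemma adj_neq x y : adj x y -> x != y.
Proof. by rewrite /adj; lia. Qed.

Lemma adjC x y : adj x y = adj y x.
Proof. by rewrite /adj orbC. Qed.

(** Adding a box only affects what can be added on the two neighbouring
    diagonals. *)
Lemma valid_swap h d e w :
  ~~ adj d e -> valid h (d :: e :: w) = valid h (e :: d :: w).
Proof.
move=> nde; have [->//|dne] := eqVneq d e.
rewrite /= growC !andbA; congr (_ && _).
by apply/idP/idP; move: nde dne; rewrite /adj /addable /grow; lia.
Qed.

(** The second box on the diagonal [x] has its upper neighbour on the diagonal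
    [x.+1] and its left neighbour on the diagonal [x.-1]; both must have been
    added since the first one. *)
Lemma valid_gap h (x : nat) (u w : seq nat) : x \notin u -> valid h (x :: u ++ x :: w) ->
  cnt x.+1 u = 1 /\ (0 < x -> cnt x.-1 u = 1).
Proof.
move=> /cnt0 xu; rewrite /= valid_cat /addable /= /addable !grownE xu.
by rewrite /grow; lia.
Qed.

Lemma valid_neq h (x y : nat) w : valid h (x :: y :: w) -> x != y.
Proof.
move=> v; apply/eqP => xy; rewrite -xy in v.
by have [] := @valid_gap h x [::] w _ v.
Qed.

(** A single letter can supply both neighbours only if there is no left
    neighbour, that is, on the main diagonal. *)
Lemma valid_braid h (x y : nat) w :
  valid h (x :: y :: x :: w) -> x = 0 /\ y = 1.
Proof.
move=> v; have xy := valid_neq v.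
have [] := @valid_gap h x [:: y] w _ v; first by rewrite inE.
by rewrite /=; lia.
Qed.

(** The particle [x] travels to the right through [ys].  It passes
    the letters that are not adjacent to it.  When it meets an adjacent letter
    [y], the boxes stay where they are but change hands: the box of content [x] joins
    [ys] and the particle goes on with content [y]. *)
Fixpoint pass (x : nat) (ys : seq nat) : seq nat * nat :=
  if ys is y :: ys' then
    if adj x y then (x :: (pass y ys').1, (pass y ys').2)
    else (y :: (pass x ys').1, (pass x ys').2)
  else ([::], x).

Lemma size_pass x ys : size (pass x ys).1 = size ys.
Proof. by elim: ys x => //= y ys IH x; case: ifP => _ /=; rewrite IH. Qed.

Lemma perm_pass x ys :
  perm_eq ((pass x ys).2 :: (pass x ys).1) (x :: ys).
Proof.
elim: ys x => //= y ys IH x; case: ifP => _ /=.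
  by have /permP p := IH y; apply/permP => a; move: (p a) => /=; lia.
by have /permP p := IH x; apply/permP => a; move: (p a) => /=; lia.
Qed.

Lemma mem_pass2 x ys : (pass x ys).2 \in x :: ys.
Proof. by rewrite -(perm_mem (perm_pass x ys)) mem_head. Qed.

Lemma pass_id x ys : all (fun y => ~~ adj x y) ys -> pass x ys = (ys, x).
Proof. by elim: ys => //= y ys IH /andP[/negbTE -> /IH ->]. Qed.

(** As a word of contents, the passage is a sequence of exchanges of
    non-adjacent letters. *)
Lemma valid_pass h x ys w :
  valid h (x :: ys ++ w) = valid h ((pass x ys).1 ++ (pass x ys).2 :: w).
Proof.
elim: ys x h => //= y ys IH x h; case: ifP => xy /=.
  by congr (_ && _); rewrite -IH.
by rewrite -IH -[LHS]/(valid h (x :: y :: ys ++ w)) valid_swap ?xy.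
Qed.

Lemma valid_pass1 h x ys : valid h (x :: ys) -> valid h (pass x ys).1.
Proof. by rewrite -{1}[ys]cats0 valid_pass valid_cat => /andP[]. Qed.

Definition desc (c : nat) (w : seq nat) : bool :=
  if w is c' :: _ then c' < c else false.
Definition asc (c : nat) (w : seq nat) : bool :=
  if w is c' :: _ then c < c' else true.

Lemma path_asc c w : path ltn c w = asc c w && sorted ltn w.
Proof. by case: w. Qed.

Lemma valid_asc h c w : valid h (c :: w) -> asc c w = ~~ desc c w.
Proof. by case: w => //= d w /valid_neq; rewrite /asc /desc; lia. Qed.

(** Strictly decreasing up to its minimum, then strictly increasing: the
    contents of a strip, listed with its primed boxes from top to bottom and
    then its unprimed boxes from left to right. *)
Fixpoint vee (w : seq nat) : bool :=
  if w is c :: w' then vee w' && (desc c w' || path ltn c w') else true.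

Lemma sorted_vee w : sorted ltn w -> vee w.
Proof.
elim: w => //= c w IH p; rewrite IH ?p ?orbT //.
by move: p; rewrite path_asc => /andP[].
Qed.

Lemma vee0 w : vee (0 :: w) -> sorted ltn (0 :: w).
Proof. by case: w => //= c w /andP[]. Qed.

(** Contents move by steps of one and consecutive contents of a valid word
    differ, so a comparison cannot be reversed. *)
Lemma desc_pass_far h x y ys : ~~ adj x y -> valid h (x :: y :: ys) ->
  desc y (pass x ys).1 = desc y ys.
Proof.
move=> nxy v; have xy := valid_neq v.
case: ys v => //= z ys v; case: ifP => //= xz.
have yz : y != z by move: v; case/andP=> _; apply: (valid_neq).
by move: nxy xz yz xy; rewrite /adj; lia.
Qed.

(** As for [desc_pass_far]; only in the word 0 1 0 are two equal contents
    separated by a single letter. *)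
Lemma desc_pass_near h x y ys : adj x y -> valid h (x :: y :: ys) ->
  ~~ [&& x == 0, y == 1 & desc 1 ys] ->
  desc x (pass y ys).1 = desc y ys.
Proof.
move=> xy v; case: ys v => //= z ys v; case: ifP => //= yz.
  have [zx|zx] := eqVneq z x.
    by have [] := @valid_braid h x y ys; [rewrite -{2}zx | move=> -> ->; lia].
  by move: xy yz; rewrite /adj; lia.
have yz' : y != z by case/andP: v => _; apply: valid_neq.
have [zx|zx] := eqVneq z x.
  by have [] := @valid_braid h x y ys; [rewrite -{2}zx | move=> -> ->; lia].
by move: xy yz; rewrite /adj; lia.
Qed.

Lemma valid_behead h x y ys : ~~ adj x y -> valid h (x :: y :: ys) ->
  valid (grow h y) (x :: ys).
Proof. by move=> nxy; rewrite valid_swap //= => /andP[]. Qed.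

Lemma sorted_pass h x ys : sorted ltn ys -> valid h (x :: ys) ->
  sorted ltn (pass x ys).1.
Proof.
elim: ys x h => //= y ys IH x h p v.
move: (p); rewrite path_asc => /andP[ay sy].
have vp : valid h ((pass x (y :: ys)).1).
  exact: (@valid_pass1 h x (y :: ys) v).
case: ifP => xy /=.
  rewrite path_asc (IH _ (grow h x)) ?andbT //; last by case/andP: v.
  rewrite (@valid_asc h); last by move: vp; rewrite /= xy.
  rewrite (@desc_pass_near h) // -?(@valid_asc (grow h x) y ys) //.
    by case/andP: v.
  apply/negP => /and3P[_ /eqP y1 d]; move: ay; rewrite y1.
  by case: (ys) d => //= z zs; lia.
rewrite path_asc (IH _ (grow h y)) ?andbT //; last first.
  by apply: valid_behead v; rewrite xy.
rewrite (@valid_asc h); last by move: vp; rewrite /= xy.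
rewrite (@desc_pass_far h) ?xy // -?(@valid_asc (grow h x) y ys) //.
by case/andP: v.
Qed.

(** After 0 the word increases, and a content 1 could follow the initial 1
    only after a content 2. *)
Lemma vee_after_braid h ys : vee (0 :: ys) -> valid h (1 :: 0 :: ys) ->
  all (fun y => 1 < y) ys.
Proof.
move=> /vee0 /= p v; have := order_path_min ltn_trans p.
case: ys p v => //= y ys /andP[y0 p] v /andP[_ _].
have y1 : y != 1.
  by apply/eqP => yE; move: v; rewrite yE => /(@valid_braid h 1 0) [].
apply/andP; split; first lia.
apply: sub_all (order_path_min ltn_trans p) => z /=; lia.
Qed.

(** Descents are preserved, except that 1 0 crossed by a particle of content 0
    becomes 0 1; since 0 was the minimum, the word remains vee-shaped. *)
Lemma pass_vee h x ys : vee ys -> valid h (x :: ys) -> vee (pass x ys).1.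
Proof.
elim: ys x h => //= y ys IH x h /andP[vy dp] v.
have vp : valid h ((pass x (y :: ys)).1).
  exact: (@valid_pass1 h x (y :: ys) v).
have [/and3P[/eqP x0 /eqP y1 d]|nS] := boolP [&& x == 0, y == 1 & desc 1 ys].
  subst x y; case: ys {IH vp dp} v vy d => //= z ys v vy; rewrite ltnS leqn0.
  move=> /eqP z0; subst z => /=.
  have a : all (fun y => 1 < y) ys.
    by apply: (@vee_after_braid (grow h 0)) => //; case/andP: v.
  rewrite pass_id; last by apply: sub_all a => t; rewrite /adj; lia.
  move: (vee0 vy) => /= p0.
  have p1 : path ltn 1 ys.
    by case: (ys) a p0 => //= t s /andP[-> _] /andP[].
  by rewrite /= p1 (sorted_vee (path_sorted p1)) !orbT.
case: ifP => xy /=.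
  rewrite (IH _ (grow h x)) //=; last by case/andP: v.
  rewrite (@desc_pass_near h) //; case/orP: dp => [->//|p].
  apply/orP; right; have := @sorted_pass h x (y :: ys) p v.
  by rewrite /= xy.
rewrite (IH _ (grow h y)) //=; last by apply: valid_behead v; rewrite xy.
rewrite (@desc_pass_far h) ?xy //; case/orP: dp => [->//|p].
apply/orP; right; have := @sorted_pass h x (y :: ys) p v.
by rewrite /= xy.
Qed.

Lemma valid_tail h x w : valid h (x :: w) -> valid (grow h x) w.
Proof. by case/andP. Qed.

Lemma valid_swap2 h x y z w : ~~ adj y z ->
  valid h (x :: y :: z :: w) -> valid h (x :: z :: y :: w).
Proof.
move=> yz; rewrite -[valid h (x :: y :: z :: w)]/(_ && valid (grow h x) (y :: z :: w)).
by rewrite valid_swap.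
Qed.

(** Two consecutive particles keep their relative order, for the same reason
    that descents persist.  The exception is the pair 0 1 meeting a letter 0:
    it becomes 1 0.  That is the moment at which (S4) or (S7) applies, and it
    is detected afterwards by the final content of the second particle. *)
Lemma desc_pass_pass h u v ys : vee ys -> valid h (u :: v :: ys) ->
  (v < u) = ((pass v ys).2 < (pass u (pass v ys).1).2)
  \/ u = 0 /\ (pass v ys).2 = 0.
Proof.
elim: ys u v h => [|y ys IH] u v h; first by left.
case/andP=> vy dy val.
have uv := valid_neq val.
have vy' := valid_neq (valid_tail val).
rewrite /=; case: (boolP (adj v y)) => avy /=.
  case: (boolP (adj u v)) => auv /=.
    have [yu|yu] := eqVneq y u.
      subst y; have [u0 v1] := valid_braid val; subst u v.
      right; split=> //.
      have a : all (fun y => 1 < y) ys.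
        by apply: vee_after_braid (valid_tail val); apply/andP.
      by rewrite pass_id //; apply: sub_all a => t; rewrite /adj; lia.
    have [||<-|[v0]] := IH v y (grow h u) => //; first exact: valid_tail val.
      by left; move: auv avy yu; rewrite /adj; lia.
    by move: auv avy yu; rewrite /adj v0; lia.
  have val2 := valid_behead auv val; have uy := valid_neq val2.
  have [||<-|ex] := IH u y (grow h v) => //; last by right.
  by left; move: auv avy uy uv vy'; rewrite /adj; lia.
have val2 := valid_swap2 avy val; have uy := valid_neq val2.
case: (boolP (adj u y)) => auy /=.
  have [||<-|[y0 p0]] := IH y v (grow h u) => //; first exact: valid_tail val2.
    by left; move: avy auy uy uv vy'; rewrite /adj; lia.
  (* Here [y] has content 0, so the letters after it are positive and [v] cannot
     end with content 0. *)
  have := mem_pass2 v ys; rewrite p0 in_cons; subst y.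
  have /vee0 /= p : vee (0 :: ys) by apply/andP.
  case/orP => [|/(allP (order_path_min ltn_trans p))//]; lia.
have [||<-|ex] := IH u v (grow h y) => //; first exact: valid_behead val2.
  by left.
by right.
Qed.

(** Tableau infusion, that is, switching by jeu de taquin, of two strips given
    by their words: the letters of [xs] pass through [ys], the last one first. *)
Fixpoint infuse (xs ys : seq nat) : seq nat * seq nat :=
  if xs is x :: xs' then
    ((pass x (infuse xs' ys).1).1, (pass x (infuse xs' ys).1).2 :: (infuse xs' ys).2)
  else (ys, [::]).

Lemma infuse_rcons xs x ys : infuse (rcons xs x) ys =
  ((infuse xs (pass x ys).1).1, rcons (infuse xs (pass x ys).1).2 (pass x ys).2).
Proof. by elim: xs => //= z xs ->. Qed.

(** The same crossings as in [pass], seen from the other word: [y] travels to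
    the left through [xs]. *)
Fixpoint pass_left (xs : seq nat) (y : nat) : nat * seq nat :=
  if xs is x :: xs' then
    if adj x (pass_left xs' y).1 then (x, (pass_left xs' y).1 :: (pass_left xs' y).2)
    else ((pass_left xs' y).1, x :: (pass_left xs' y).2)
  else (y, [::]).

Lemma infuse_nil xs : infuse xs [::] = ([::], xs).
Proof. by elim: xs => //= x xs ->. Qed.

(** The grid of crossings is read by columns instead of by rows. *)
Lemma infuse_cons xs y ys : infuse xs (y :: ys) =
  ((pass_left xs y).1 :: (infuse (pass_left xs y).2 ys).1, (infuse (pass_left xs y).2 ys).2).
Proof. by elim: xs => //= x xs ->; case: ifP => /= ->. Qed.

Lemma passK x ys : pass_left (pass x ys).1 (pass x ys).2 = (x, ys).
Proof.
elim: ys x => //= y ys IH x; case: ifP => /= xy; rewrite IH /= ?xy //.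
by rewrite adjC xy.
Qed.

(** By [infuse_cons] the second infusion can be computed by columns, and each
    of these columns undoes a row of the first infusion. *)
Lemma infuseK xs ys : infuse (infuse xs ys).1 (infuse xs ys).2 = (xs, ys).
Proof.
elim: xs => [|x xs IH]; first exact: infuse_nil.
by rewrite /= infuse_cons passK /= IH.
Qed.

Lemma valid_infuse h xs ys w :
  valid h (xs ++ ys ++ w) = valid h ((infuse xs ys).1 ++ (infuse xs ys).2 ++ w).
Proof.
elim: xs h => //= x xs IH h.
by rewrite -valid_pass /= IH.
Qed.

(** * Fillings drawn by labelled words *)

Definition cell (h : nat -> nat) (d : nat) : box := (h d, h d + d).

Fixpoint filled (h : nat -> nat) (w : seq (nat * letter)) : filling :=
  if w is e :: w' then
    fun x => if x == cell h e.1 then Some e.2 else filled (grow h e.1) w' x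
  else fun=> None.

Lemma unzip1_cat (T U : Type) (w1 w2 : seq (T * U)) :
  unzip1 (w1 ++ w2) = unzip1 w1 ++ unzip1 w2.
Proof. exact: map_cat. Qed.

Lemma cell_inj g h d e : cell g d = cell h e -> d = e /\ g d = h e.
Proof. by case=> -> /addnI. Qed.

Lemma cell_eq h d e : (cell h d == cell h e) = (d == e).
Proof.
by apply/eqP/eqP => [/cell_inj[]//|->].
Qed.

Lemma cell_grow h d e : d != e -> cell (grow h d) e = cell h e.
Proof. by move=> de; rewrite /cell /grow eq_sym (negbTE de) addn0. Qed.

Lemma filled_cat h w1 w2 x : filled h (w1 ++ w2) x =
  if filled h w1 x is Some l then Some l else filled (grown h (unzip1 w1)) w2 x.
Proof. by elim: w1 h => //= e w1 IH h; case: ifP => // _; rewrite IH. Qed.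

Lemma filled_some h w x l : filled h w x = Some l -> exists w1 d w2,
  w = w1 ++ (d, l) :: w2 /\ x = cell (grown h (unzip1 w1)) d.
Proof.
elim: w h => //= -[d l'] w IH h /=; case: eqP => [-> [<-]|_ /IH].
  by exists [::], d, w.
by move=> [w1 [e [w2 [-> ->]]]]; exists ((d, l') :: w1), e, w2.
Qed.

Lemma filled_None_ge h w d r : grown h (unzip1 w) d <= r -> filled h w (r, r + d) = None.
Proof.
move=> hr; case E: (filled _ _ _) => [l|] //; move: (filled_some E) => [w1 [e [w2 [wE]]]].
move=> xE; have [de re] := @cell_inj (fun=> r) (grown h (unzip1 w1)) d e xE.
by move: hr; rewrite wE unzip1_cat /= de re !grownE cnt_cat cnt_cons eqxx; lia.
Qed.

Lemma filled_None_lt h w d r : r < h d -> filled h w (r, r + d) = None.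
Proof.
move=> hr; case E: (filled _ _ _) => [l|] //; move: (filled_some E) => [w1 [e [w2 [wE]]]].
move=> xE; have [de re] := @cell_inj (fun=> r) (grown h (unzip1 w1)) d e xE.
by move: hr; rewrite de re grownE; lia.
Qed.

Lemma filled_diag h w x : isSome (filled h w x) -> x.1 <= x.2.
Proof.
case E: (filled h w x) => [l|] // _; move: (filled_some E) => [w1 [e [w2 [_ ->]]]].
by rewrite /= leq_addr.
Qed.

Lemma filled_mid h w1 e w2 :
  filled h (w1 ++ e :: w2) (cell (grown h (unzip1 w1)) e.1) = Some e.2.
Proof. by rewrite filled_cat filled_None_ge //= eqxx. Qed.

Definition first_label (d : nat) (w : seq (nat * letter)) : option letter :=
  ohead [seq e.2 | e <- w & e.1 == d].

Lemma filled_first h w d : filled h w (cell h d) = first_label d w.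
Proof.
elim: w h => //= -[e l] w IH h /=; rewrite /first_label /= cell_eq eq_sym.
by case: eqVneq => //= ed; rewrite -(cell_grow h ed) IH.
Qed.

Lemma filled_comm h w1 e1 e2 w2 : e1.1 != e2.1 ->
  filled h (w1 ++ e1 :: e2 :: w2) = filled h (w1 ++ e2 :: e1 :: w2).
Proof.
move=> ne; apply: funext => x; rewrite !filled_cat; case: (filled h w1 x) => //=.
rewrite !cell_grow // 1?eq_sym // growC.
case: (eqVneq x (cell _ e1.1)) => [->|//].
by rewrite cell_eq (negbTE ne).
Qed.

Lemma filled_swap h w1 x y l1 l2 w2 : x != y ->
  swap_boxes (filled h (w1 ++ (x, l1) :: (y, l2) :: w2))
    (cell (grown h (unzip1 w1)) x) (cell (grown h (unzip1 w1)) y) =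
  filled h (w1 ++ (x, l2) :: (y, l1) :: w2).
Proof.
move=> ne; set H := grown _ _; apply: funext => z; rewrite /swap_boxes.
have E l l' t : filled h (w1 ++ (x, l) :: (y, l') :: w2) t =
    if filled h w1 t is Some m then Some m else
    if t == cell H x then Some l else if t == cell H y then Some l'
    else filled (grow (grow H x) y) w2 t.
  by rewrite filled_cat /= cell_grow.
have N d : filled h w1 (cell H d) = None by apply: filled_None_ge.
rewrite !E; case: (eqVneq z (cell H x)) => [->|zx].
  by rewrite !N !cell_eq ?eqxx [y == x]eq_sym (negbTE ne).
case: (eqVneq z (cell H y)) => [->|zy].
  by rewrite !N !cell_eq ?eqxx.
by [].
Qed.

Lemma box_right_cell h d : addable h d -> box_right (cell h d) = cell h d.+1.
Proof.
by case/andP=> _ /eqP E; rewrite /cell /box_right /= E addnS.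
Qed.

Lemma box_below_cell h d : 0 < d -> addable h d ->
  box_below (cell h d) = cell h d.-1.
Proof.
case: d => // d _ /andP[/= /eqP E _]; rewrite /cell /box_below /= E.
by rewrite addSnnS.
Qed.

(** Validity forces the next box on the diagonal [x.+1] to be the right
    neighbour of the present one. *)
Lemma filled_right h w1 x l w2 : valid h (unzip1 (w1 ++ (x, l) :: w2)) ->
  filled h (w1 ++ (x, l) :: w2) (box_right (cell (grown h (unzip1 w1)) x))
  = first_label x.+1 w2.
Proof.
rewrite unzip1_cat valid_cat => /andP[_] /= /andP[ad _].
rewrite box_right_cell // filled_cat filled_None_ge //= cell_eq eqn_leq ltnn.
by rewrite -(@cell_grow _ x) ?filled_first // neq_ltn ltnSn.
Qed.

(** Validity forces the next box on the diagonal [x.-1] to be the lower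
    neighbour of the present one. *)
Lemma filled_below h w1 x l w2 : 0 < x -> valid h (unzip1 (w1 ++ (x, l) :: w2)) ->
  filled h (w1 ++ (x, l) :: w2) (box_below (cell (grown h (unzip1 w1)) x))
  = first_label x.-1 w2.
Proof.
move=> x0; rewrite unzip1_cat valid_cat => /andP[_] /= /andP[ad _].
have xx : x != x.-1 by lia.
rewrite box_below_cell // filled_cat filled_None_ge //= cell_eq eq_sym (negbTE xx).
by rewrite -(@cell_grow _ x) ?filled_first.
Qed.

Lemma filled_below0 h w r : filled h w (r.+1, r) = None.
Proof.
case E: (filled h w _) => [l|] //; have /= := @filled_diag h w (r.+1, r).
by rewrite E ltnn => /(_ isT).
Qed.

Lemma first_label_notin d w : d \notin unzip1 w -> first_label d w = None.
Proof.
elim: w => //= -[e l] w IH; rewrite /first_label /= inE negb_or eq_sym => /andP[ed].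
by rewrite (negbTE ed).
Qed.

Lemma first_label_in d w : d \in unzip1 w -> exists w1 l w2,
  [/\ w = w1 ++ (d, l) :: w2, d \notin unzip1 w1 & first_label d w = Some l].
Proof.
elim: w => //= -[e l] w IH; rewrite /first_label /= inE [d == e]eq_sym.
case: eqVneq => [-> _|ne /= /IH[w1 [m [w2 [-> dw E]]]]].
  by exists [::], l, w.
exists ((e, l) :: w1), m, w2; split=> //.
by rewrite /= inE negb_or eq_sym ne.
Qed.

(** Both [i] and [i'] are allowed. *)
Definition letters (i : nat) (w : seq (nat * letter)) : bool :=
  all (fun e => e.2.1 == i) w.

Lemma first_label_letters i d w : letters i w -> d \in unzip1 w ->
  has_letter i (first_label d w).
Proof.
move=> aw /first_label_in [w1 [l [w2 [wE _ ->]]]].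
by move: aw; rewrite wE /letters all_cat /= => /and3P[_ ->].
Qed.

Definition read_before (x y : box) : bool :=
  (y.1 < x.1) || (y.1 == x.1) && (x.2 < y.2).

Lemma reading_order_pairwise la : pairwise read_before (reading_order la).
Proof.
rewrite /reading_order; elim: (size la) => // n IH.
rewrite -addn1 iotaD rev_cat /= pairwise_cat IH andbT; apply/andP; split.
  apply/allrelP => x y /mapP[c _ ->] /flattenP[s /mapP[r]].
  rewrite mem_rev mem_iota => rn -> /mapP[c' _ ->]; rewrite /read_before /=.
  by move: rn; lia.
rewrite pairwise_map; have := iota_ltn_sorted n (nth 0 la n).
rewrite (sorted_pairwise ltn_trans); apply: sub_pairwise => i j.
by rewrite /read_before /= eqxx ltnn.
Qed.

Lemma mem_reading_order la x : (x \in reading_order la) = in_shape la x.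
Proof.
apply/flattenP/idP.
  case=> s /mapP[r]; rewrite mem_rev mem_iota => rn -> /mapP[c].
  by rewrite mem_iota => rc -> ; rewrite /in_shape.
case: x => r c; rewrite /in_shape /= => rc.
have rn : r < size la.
  by rewrite ltnNge; apply/negP => /(nth_default 0) E; move: rc; rewrite E; lia.
exists [seq (r, c) | c <- iota r (nth 0 la r)].
  by apply/mapP; exists r => //; rewrite mem_rev mem_iota.
by apply/mapP; exists c => //; rewrite mem_iota.
Qed.

(** The order may have ties; it is enough that none involves [x]. *)
Lemma ohead_filter_sorted (T : eqType) (R : rel T) (P : pred T) s x :
  transitive R -> sorted R s -> x \in s -> P x ->
  (forall y, y \in s -> P y -> y != x -> ~~ R y x) ->
  ohead [seq y <- s | P y] = Some x.
Proof.
move=> Rt /(sorted_filter Rt P) ss xs Px un.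
have : x \in [seq y <- s | P y] by rewrite mem_filter Px.
have sub : {subset [seq y <- s | P y] <= s} by move=> y; rewrite mem_filter => /andP[].
have sP y : y \in [seq y <- s | P y] -> P y by rewrite mem_filter => /andP[].
case E : [seq y <- s | P y] ss sub sP => [|y t] //= p sub sP.
rewrite inE eq_sym => /orP[/eqP->//|xt]; case: (eqVneq y x) => [->//|yx].
have yt : y \in y :: t by rewrite mem_head.
by have := allP (order_path_min Rt p) x xt; rewrite (negbTE (un _ (sub _ yt) (sP _ yt) yx)).
Qed.

Lemma ohead_filter_pairwise (T : eqType) (R : rel T) (P : pred T) s x :
  pairwise R s -> x \in s -> P x ->
  (forall y, y \in s -> P y -> y != x -> ~~ R y x) ->
  ohead [seq y <- s | P y] = Some x.
Proof.
elim: s => //= y s IH /andP[/allP ys ps]; rewrite inE.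
case: (eqVneq x y) => [->|xy /= xs Px un]; first by move=> _ ->.
have Py : P y = false.
  apply/negP => Py; have := un y (mem_head _ _) Py.
  by rewrite eq_sym xy ys // => /(_ isT).
by rewrite Py; apply: IH => // z zs; apply: un; rewrite inE zs orbT.
Qed.

Section Chosen.
Variables (la : seq nat) (a b : nat).

Definition cand (S : filling) (p : bool) (x : box) : bool :=
  (S x == Some (a, p)) && (b_right b S x || b_below b S x).

Lemma chosen_unprimed S x : in_shape la x -> cand S false x ->
  (forall y, cand S false y -> y != x -> y.2 < x.2) ->
  chosen_box la a b S = Some x.
Proof.
move=> xl cx un; rewrite /chosen_box /candidates.
rewrite (@ohead_filter_sorted _ (fun x y : box => y.2 <= x.2) _ _ x) //.
- by move=> y z t /=; lia.
- by apply: sort_sorted => y z; apply: leq_total.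
- by rewrite mem_sort mem_reading_order.
- by move=> y _ cy yx; rewrite -ltnNge; apply: un.
Qed.

Lemma chosen_primed S x : in_shape la x -> cand S true x ->
  (forall y, cand S false y = false) ->
  (forall y, cand S true y -> y != x -> y.1 < x.1) ->
  chosen_box la a b S = Some x.
Proof.
move=> xl cx nc un; rewrite /chosen_box /candidates.
rewrite (@eq_filter _ _ pred0) => [|y]; last exact: nc.
rewrite filter_pred0 /=.
apply: (ohead_filter_pairwise (reading_order_pairwise la)) => //.
  by rewrite mem_reading_order.
by move=> y _ cy yx; have := un y cy yx; rewrite /read_before; lia.
Qed.

Lemma chosen_none S : (forall p y, cand S p y = false) ->
  chosen_box la a b S = None.
Proof.
move=> nc; rewrite /chosen_box /candidates.
rewrite !(@eq_filter _ (fun x => _ && _) pred0) ?filter_pred0 // => y; exact: nc.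
Qed.

End Chosen.

(** * The box chosen by the switching process *)

(** The condition on [h] that makes it come from a shifted shape: rows and
    columns have no gaps, so [h d] decreases in [d] and [h d + d] increases. *)
Definition profile (h : nat -> nat) : Prop :=
  forall d, h d.+1 <= h d <= (h d.+1).+1.

Lemma shape_le h d e : profile h -> d <= e -> h e <= h d.
Proof.
move=> sh; elim: e => [|e IH]; first by rewrite leqn0 => /eqP->.
rewrite leq_eqVlt => /orP[/eqP->//|/IH]; move: (sh e); lia.
Qed.

Lemma shape_leD h d e : profile h -> d <= e -> h d + d <= h e + e.
Proof.
move=> sh; elim: e => [|e IH]; first by rewrite leqn0 => /eqP->.
rewrite leq_eqVlt => /orP[/eqP->//|/IH]; move: (sh e); lia.
Qed.

Lemma shape_grow h d : profile h -> addable h d -> profile (grow h d).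
Proof.
move=> sh; rewrite /addable /grow => ad e; move: (sh e).
have [dE|ne] := eqVneq d e; first by subst d; move: ad; lia.
have [dE|ne'] := eqVneq d e.+1; first by subst d; move: ad => /=; lia.
by lia.
Qed.

Lemma shape_grown h w : profile h -> valid h w -> profile (grown h w).
Proof.
elim: w h => //= d w IH h sh /andP[ad v]; apply: IH v; exact: shape_grow.
Qed.

Lemma letters_cat i w1 w2 : letters i (w1 ++ w2) = letters i w1 && letters i w2.
Proof. exact: all_cat. Qed.

Lemma first_label_cat d w1 w2 : first_label d (w1 ++ w2) =
  if d \in unzip1 w1 then first_label d w1 else first_label d w2.
Proof.
elim: w1 => //= -[e l] w IH /=; rewrite /first_label /= inE [d == e]eq_sym.
by case: eqVneq => //= _; exact: IH.
Qed.

Lemma first_label_other i j d w : i != j -> letters i w -> has_letter j (first_label d w) = false.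
Proof.
move=> ij lw; case: (boolP (d \in unzip1 w)).
  by move/(first_label_letters lw); case: (first_label d w) => //= l /eqP ->; apply: negbTE.
by move/first_label_notin ->.
Qed.

Section Steps.
Variables (la : seq nat) (a b : nat) (h : nat -> nat).
Hypothesis ab : a != b.
Hypothesis sh : profile h.

(** The order in which the process chooses boxes, seen from the particle at
    [p] with prime [l]: the waiting letters [X] do not come before it. *)
Definition behind (X : seq (nat * letter)) (p : box) (l : bool) : Prop :=
  forall X1 d l' X2, X = X1 ++ (d, (a, l')) :: X2 ->
  if l then l' && ((cell (grown h (unzip1 X1)) d).1 < p.1)
  else l' || ((cell (grown h (unzip1 X1)) d).2 < p.2).

Lemma has_b_first d Y Z : letters b Y -> letters a Z ->
  has_letter b (first_label d (Y ++ Z)) = (d \in unzip1 Y).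
Proof.
move=> lY lZ; rewrite first_label_cat; case: ifP => [dY|_].
  exact: first_label_letters.
by apply: first_label_other lZ.
Qed.

(** Neighbours to the right and below come later in the word, where there is
    no [b] left. *)
Lemma not_cand V d l w q : valid h (unzip1 (V ++ (d, (a, l)) :: w)) ->
  letters a w -> q = cell (grown h (unzip1 V)) d ->
  ~ (b_right b (filled h (V ++ (d, (a, l)) :: w)) q ||
     b_below b (filled h (V ++ (d, (a, l)) :: w)) q).
Proof.
move=> v lw ->; rewrite /b_right /b_below => /orP[].
  by rewrite filled_right // (first_label_other _ ab).
case: (ltnP 0 d) => [d0|]; first by rewrite filled_below // (first_label_other _ ab).
by rewrite leqn0 => /eqP->; rewrite /box_below /= addn0 filled_below0.
Qed.

Section State.
Variables (X Y1 : seq (nat * letter)) (x : nat) (l : bool).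
Variables (Y2 Z : seq (nat * letter)).
Let W := X ++ Y1 ++ (x, (a, l)) :: Y2 ++ Z.
Hypothesis v : valid h (unzip1 W).
Hypothesis dom : forall q, isSome (filled h W q) -> in_shape la q.
Hypotheses (lX : letters a X) (lY1 : letters b Y1).
Hypotheses (lY2 : letters b Y2) (lZ : letters a Z).
Let H := grown h (unzip1 (X ++ Y1)).
Let p := cell H x.

Lemma stateE : W = (X ++ Y1) ++ (x, (a, l)) :: Y2 ++ Z.
Proof. by rewrite /W catA. Qed.

Lemma state_here : filled h W p = Some (a, l).
Proof. by rewrite stateE; apply: filled_mid. Qed.

Lemma state_addable : addable H x.
Proof.
move: v; rewrite stateE unzip1_cat valid_cat => /andP[_] /=.
by case/andP.
Qed.

Lemma state_right : filled h W (box_right p) = first_label x.+1 (Y2 ++ Z).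
Proof. by move: v; rewrite stateE; apply: filled_right. Qed.

Lemma state_below : 0 < x -> filled h W (box_below p) = first_label x.-1 (Y2 ++ Z).
Proof. by move: v; rewrite stateE => + x0; apply: filled_below. Qed.

Lemma state_b_right : b_right b (filled h W) p = (x.+1 \in unzip1 Y2).
Proof. by rewrite /b_right state_right has_b_first. Qed.

Lemma state_b_below : b_below b (filled h W) p = (0 < x) && (x.-1 \in unzip1 Y2).
Proof.
rewrite /b_below; case: ltnP => [x0|]; first by rewrite state_below // has_b_first.
by rewrite leqn0 /p => /eqP ->; rewrite /box_below /= addn0 filled_below0.
Qed.

(** The word of a state consists of the waiting letters [X], the letters [Y1]
    that the particle has crossed, the particle, the letters [Y2] still to be
    crossed, and the letters [Z] that have finished.  The last ones have no [b]
    after them, so only the waiting letters can compete with the particle. *)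
Lemma state_other q l' : cand a b (filled h W) l' q -> q != p ->
  exists X1 d X2, X = X1 ++ (d, (a, l')) :: X2 /\
    q = cell (grown h (unzip1 X1)) d.
Proof.
case/andP=> /eqP Wq nb qp; case Xq: (filled h X q) => [m|].
  have Em : m = (a, l') by move: Wq; rewrite /W filled_cat Xq => -[].
  by move: Xq; rewrite Em => /filled_some [X1 [d [X2 E]]]; exists X1, d, X2.
exfalso; case Y1q: (filled (grown h (unzip1 X)) Y1 q) => [m|].
  have Em : m = (a, l') by move: Wq; rewrite /W filled_cat Xq filled_cat Y1q => -[].
  move: Y1q; rewrite Em => /filled_some [u [d [w [E _]]]].
  by move: lY1; rewrite E letters_cat /= (negbTE ab) !andbF.
have : filled (grow H x) (Y2 ++ Z) q = Some (a, l').
  move: Wq; rewrite /W filled_cat Xq filled_cat Y1q /=; move: qp; rewrite /p /H unzip1_cat grown_cat.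
  by move=> /negbTE ->.
rewrite filled_cat; case Y2q: (filled _ Y2 q) => [m|].
  move: Y2q => /filled_some [u [d [w [E _]]]] [Em].
  by move: lY2; rewrite E Em letters_cat /= (negbTE ab) !andbF.
move=> /filled_some [u [d [w [E qE]]]].
set V := X ++ Y1 ++ (x, (a, l)) :: Y2 ++ u.
have WE : W = V ++ (d, (a, l')) :: w by rewrite /V /W E -!catA /= -!catA.
have {}qE : q = cell (grown h (unzip1 V)) d.
  by rewrite qE /V /H !unzip1_cat /= !unzip1_cat /= !grown_cat /= grown_cat.
have lw : letters a w by move: lZ; rewrite E letters_cat => /and3P[].
by move: v nb; rewrite WE => vV; apply: not_cand.
Qed.

Lemma state_chosen : behind X p l ->
  has (adj x) (unzip1 Y2) -> chosen_box la a b (filled h W) = Some p.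
Proof.
move=> bX /hasP[y yY2 xy].
have inp : in_shape la p by apply: dom; rewrite state_here.
have cp : cand a b (filled h W) l p.
  rewrite /cand state_here eqxx state_b_right state_b_below.
  case/orP: xy => /eqP E; apply/orP; [right|left]; last by rewrite -E.
  by rewrite E /= yY2.
move: bX cp; rewrite /behind; case: l => bX cp.
  apply: chosen_primed => // q; last first.
    by move=> cq qp; have [X1 [d [X2 [XE ->]]]] := state_other cq qp; case/andP: (bX _ _ _ _ XE).
  apply/negP => cq; case: (eqVneq q p) => [qp|qp].
    by move: cp cq; rewrite qp /cand => /andP[/eqP -> _] /andP[/eqP].
  by have [X1 [d [X2 [XE _]]]] := state_other cq qp; case/andP: (bX _ _ _ _ XE).
apply: chosen_unprimed => // q cq qp.
by have [X1 [d [X2 [XE ->]]]] := state_other cq qp; apply: (bX _ _ _ _ XE).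
Qed.

End State.
End Steps.

(** * Single switches *)

(** The canonical labels: a letter of a vee-shaped word is primed if and only
    if it is followed by a smaller content.  The word [t] is what follows [w]. *)
Fixpoint labelled (i : nat) (w t : seq nat) : seq (nat * letter) :=
  if w is c :: w' then (c, (i, desc c (w' ++ t))) :: labelled i w' t else [::].

Lemma unzip1_labelled i w t : unzip1 (labelled i w t) = w.
Proof. by elim: w => //= c w ->. Qed.

Lemma letters_labelled i w t : letters i (labelled i w t).
Proof. by elim: w => //= c w ->; rewrite eqxx. Qed.

Lemma labelled_cat i u v t : labelled i (u ++ v) t = labelled i u (v ++ t) ++ labelled i v t.
Proof. by elim: u => //= c u ->; rewrite catA. Qed.

(** A primed letter belongs to the decreasing part of the word. *)
Lemma vee_primed c w d i j : vee (c :: w) ->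
  first_label d (labelled i w [::]) = Some (j, true) -> d < c.
Proof.
elim: w c => [|c' w IH] c //= /andP[/andP[vw dw] dc].
rewrite /first_label /= cats0; case: (eqVneq c' d) => [E|_].
  subst d; move=> [_ /= dd]; case/orP: dc => [|/andP[_ p]]; first by lia.
  by move: dd p; case: (w) => //= e s; lia.
move=> E; have dc' : d < c' by apply: IH E; rewrite /= vw.
case/orP: dc => [|/andP[_ p]]; first by lia.
have : d \in w.
  by case: (boolP (d \in w)) => // dw'; move: E;
    rewrite -/(first_label d (labelled i w [::])) first_label_notin // unzip1_labelled.
by move/(allP (order_path_min ltn_trans p)) => /=; lia.
Qed.

(** The common effect of (S3), (S4) and (S7). *)
Lemma filled_swap3 h U d e l0 l1 l2 m V : d != e ->
  let G := grown h (unzip1 U) in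
  relabel (swap_boxes (filled h (U ++ (d, l0) :: (e, l1) :: (d, l2) :: V))
    (cell G d) (cell (grow G d) d)) (cell G e) m =
  filled h (U ++ (d, l2) :: (e, m) :: (d, l0) :: V).
Proof.
move=> de G; set c1 := cell G d; set c2 := cell G e; set c3 := cell _ d.
have E k0 k1 k2 t : filled h (U ++ (d, k0) :: (e, k1) :: (d, k2) :: V) t =
    if filled h U t is Some m then Some m else
    if t == c1 then Some k0 else if t == c2 then Some k1 else
    if t == c3 then Some k2 else filled (grow (grow (grow G d) e) d) V t.
  by rewrite filled_cat /= cell_grow // (@cell_grow _ e d) // eq_sym.
have N1 f : filled h U (cell G f) = None by apply: filled_None_ge.
have N3 : filled h U c3 = None by apply: filled_None_ge; rewrite /G /grow leq_addr.
have c12 : (c1 == c2) = false by rewrite cell_eq (negbTE de).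
have c13 : (c1 == c3) = false.
  by rewrite /c1 /c3 /cell /grow xpair_eqE eqxx; lia.
have c23 : (c2 == c3) = false.
  rewrite /c2 -(cell_grow G de) /c3 cell_eq eq_sym; exact: negbTE.
apply: funext => t; rewrite /relabel /swap_boxes !E.
case: (eqVneq t c2) => [->|t2]; first by rewrite N1 eq_sym c12 ?eqxx.
case: (eqVneq t c1) => [->|t1].
  by rewrite N1 N3 ![c3 == _]eq_sym c13 c23 ?eqxx.
case: (eqVneq t c3) => [->|t3]; first by rewrite N1 N3 ?eqxx.
by [].
Qed.

Section Steps.
Variables (la : seq nat) (a b : nat) (h : nat -> nat).
Hypothesis ab : a != b.
Hypothesis sh : profile h.

Section Normal.
Variables (X Y1 : seq (nat * letter)) (x : nat) (l : bool) (y : nat).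
Variables (ys : seq nat) (Z : seq (nat * letter)).
Let W := X ++ Y1 ++ (x, (a, l)) :: labelled b (y :: ys) [::] ++ Z.
Hypothesis v : valid h (unzip1 W).
Hypothesis dom : forall q, isSome (filled h W q) -> in_shape la q.
Hypotheses (lX : letters a X) (lY1 : letters b Y1) (lZ : letters a Z).
Let H := grown h (unzip1 (X ++ Y1)).
Let p := cell H x.
Hypothesis bX : behind a h X p l.
Hypothesis vy : vee (y :: ys).

Let lY2 : letters b (labelled b (y :: ys) [::]). Proof. exact: letters_labelled. Qed.

Let bright : b_right b (filled h W) p = (x.+1 \in y :: ys).
Proof. by rewrite (state_b_right ab v) // unzip1_labelled. Qed.

Let bbelow : b_below b (filled h W) p = (0 < x) && (x.-1 \in y :: ys).
Proof. by rewrite (state_b_below ab v) // unzip1_labelled. Qed.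

Let right : filled h W (box_right p) = first_label x.+1 (labelled b (y :: ys) [::] ++ Z).
Proof. exact: state_right. Qed.

Let here : filled h W p = Some (a, l). Proof. exact: state_here. Qed.

Let ad : addable H x. Proof. exact: state_addable v. Qed.

Let right_y : x.+1 = y -> filled h W (box_right p) = Some (b, desc y ys).
Proof. by move=> E; rewrite right E /first_label /= eqxx cats0. Qed.

Let far_below : x.+1 = y -> ~~ desc y ys -> b_below b (filled h W) p = false.
Proof.
move=> xy d; rewrite bbelow; case: x xy => //= x' xy.
move: vy => /andP[_]; rewrite (negbTE d) /= => /(order_path_min ltn_trans)/allP pm.
apply/negbTE; rewrite inE negb_or; apply/andP; split; first by clear -xy; lia.
by apply/negP => /pm; rewrite -xy /=; clear; lia.
Qed.

Lemma chosen_adj : adj x y -> chosen_box la a b (filled h W) = Some p.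
Proof.
by move=> xy; apply: (state_chosen ab v dom) => //=; rewrite xy.
Qed.

(** A crossing.  If [y = x.+1] is unprimed then all later contents are larger
    than [x], so there is no [b] below and (S1) applies; if [y = x.-1], a [b]
    to the right comes later in the word, so it is unprimed and (S6) or (S2)
    applies.  In the remaining case [y] is a primed letter to the right. *)
Lemma normal_step : adj x y ->
  ~~ [&& x == 0, y == 1 & desc 1 ys] ->
  (x = 1 -> y = 0 -> l = false -> ~~ has_letter a (filled h W (p.1, p.1))) ->
  switch_step la a b (filled h W) =
  filled h (X ++ Y1 ++ (x, (b, desc y ys)) :: (y, (a, l)) :: labelled b ys [::] ++ Z).
Proof.
move=> xy n3 n4.
have xney := adj_neq xy.
rewrite /switch_step chosen_adj // /switch_at.
have -> : S3_applies b (filled h W) p = false.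
  apply/negP; rewrite /S3_applies /p /cell => /and3P[/eqP c0 /eqP r _].
  have x0 : x = 0 by apply/eqP; rewrite -(eqn_add2l (H x)) addn0 c0.
  have xyE : x.+1 = y by case: (adjP xy) => [E|->//]; rewrite E in x0.
  have := right_y xyE; rewrite /box_right /p /cell /= c0 r => -[/esym d].
  have y1 : y = 1 by rewrite -xyE x0.
  by rewrite y1 in d; move: n3; rewrite x0 y1 d.
have pat : S4_S7_pattern a b (filled h W) p -> x = 1 /\ l = false.
  rewrite /S4_S7_pattern here /p /cell => /and4P[].
  by rewrite -[(H x).+1]addn1 eqn_add2l => /eqP-> /eqP[->].
have -> : S4_applies a b (filled h W) p || S7_applies a b (filled h W) p = false.
  apply/negP => app.
  have P : S4_S7_pattern a b (filled h W) p by case/orP: app => /andP[].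
  have [x1 l0] := pat P.
  case: (eqVneq y 0) => [y0|y0].
    move: (n4 x1 y0 l0); move: P; rewrite /S4_S7_pattern /p /cell.
    by case/and4P => _ _ ->.
  have y2 : x.+1 = y by case: (adjP xy) y0 => [|->//]; rewrite x1 => -[<-].
  case/orP: app => /andP[_]; first by rewrite bright y2 mem_head.
  rewrite (right_y y2) => /eqP[d].
  have := far_below y2 (negbT d); rewrite /b_below /box_below /p /cell /=.
  move: P; rewrite /S4_S7_pattern /p /cell => /and4P[/eqP-> _ _].
  by rewrite /b_below /= => ->.
have swapE q : q = cell H y -> swap_boxes (filled h W) p q =
  filled h (X ++ Y1 ++ (x, (b, desc y ys)) :: (y, (a, l)) :: labelled b ys [::] ++ Z).
  by move=> ->; rewrite /p /H /W 2!catA filled_swap //= cats0 -catA.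
have [xyE|yxE] : x.+1 = y \/ y.+1 = x by case: (adjP xy) => ->; [right|left].
  have qE : box_right p = cell H y by rewrite -xyE; apply: box_right_cell.
  rewrite bright xyE mem_head (swapE _ qE).
  case: ifP => // bb; rewrite (right_y xyE) eqE /=.
  case: (boolP (desc y ys)) => [_|d]; first by rewrite !eqxx.
  by rewrite (far_below xyE d) in bb.
have qE : box_below p = cell H y.
  by rewrite box_below_cell ?ad // -yxE.
rewrite (swapE _ qE) bbelow -yxE /= mem_head; case: ifP => // br.
case: eqP => // E; exfalso.
have ne : (y == y.+2) = false by rewrite eqn_leq ltnNge leqnSn andbF.
move: E; rewrite right -yxE /= /first_label /= ne -/(first_label _ _) first_label_cat unzip1_labelled.
move: br; rewrite bright -yxE inE eq_sym ne /= => ->.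
by move/(vee_primed vy); rewrite ltnNge leqW.
Qed.

End Normal.

End Steps.

Lemma desc0 w : desc 0 w = false.
Proof. by case: w. Qed.

Lemma diagonal_triple h U l0 l1 l2 m V :
  let W := U ++ [:: (0, l0), (1, l1), (0, l2) & V] in
  let r := grown h (unzip1 U) 0 in
  valid h (unzip1 W) ->
  [/\ grown h (unzip1 U) 1 = r, filled h W (r, r) = Some l0,
      filled h W (r, r.+1) = Some l1, filled h W (r.+1, r.+1) = Some l2
    & relabel (swap_boxes (filled h W) (r, r) (r.+1, r.+1)) (r, r.+1) m =
      filled h (U ++ [:: (0, l2), (1, m), (0, l0) & V])].
Proof.
move=> W r v; set G := grown h (unzip1 U).
have G1 : G 1 = r.
  by move: v; rewrite /W unzip1_cat valid_cat => /andP[_ /= /and3P[/andP[_ /eqP]]].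
have c0 : cell G 0 = (r, r) by rewrite /cell addn0.
have c1 : cell G 1 = (r, r.+1) by rewrite /cell G1 addn1.
have c2 : cell (grow G 0) 0 = (r.+1, r.+1) by rewrite /cell /grow /= addn0 addn1.
split=> //.
- by rewrite -c0; apply: (@filled_mid h U (0, l0)).
- have := @filled_mid h (U ++ [:: (0, l0)]) (1, l1) ((0, l2) :: V).
  by rewrite -catA unzip1_cat grown_cat /= cell_grow // c1.
- have := @filled_mid h (U ++ [:: (0, l0); (1, l1)]) (0, l2) V.
  by rewrite -catA unzip1_cat grown_cat /= cell_grow // c2.
have := @filled_swap3 h U 0 1 l0 l1 l2 m V.
by rewrite /= -/G c0 c1 c2 => ->.
Qed.

Lemma valid_past h U e Y V : all (fun y => ~~ adj e y) Y ->
  valid h (U ++ e :: Y ++ V) = valid h (U ++ Y ++ e :: V).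
Proof. by move=> n; rewrite valid_cat valid_pass pass_id //= -valid_cat. Qed.

Section Special.
Variables (la : seq nat) (a b : nat) (h : nat -> nat).
Hypothesis ab : a != b.

(** Two crossings at once.  The label of the letter of content 1 loses its
    prime because it now follows the content 0. *)
Lemma S3_step X Y1 l ys Z :
  let W := X ++ Y1 ++ (0, (a, l)) :: labelled b [:: 1, 0 & ys] [::] ++ Z in
  valid h (unzip1 W) -> (forall q, isSome (filled h W q) -> in_shape la q) ->
  letters a X -> letters b Y1 -> letters a Z ->
  behind a h X (cell (grown h (unzip1 (X ++ Y1))) 0) l -> vee [:: 1, 0 & ys] ->
  switch_step la a b (filled h W) =
  filled h (X ++ Y1 ++ [:: (0, (b, false)), (1, (b, false)), (0, (a, l))
                   & labelled b ys [::] ++ Z]).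
Proof.
move=> W v dom lX lY1 lZ bX vy.
have WE : W = (X ++ Y1) ++ [:: (0, (a, l)), (1, (b, true)), (0, (b, false))
                            & labelled b ys [::] ++ Z].
  by rewrite /W -catA /= desc0.
rewrite /switch_step (chosen_adj ab v dom) // /switch_at /S3_applies.
move: v; rewrite WE => /(diagonal_triple (b, false)) [G1 _ E1 E2 S].
by rewrite {1}/cell addn0 eqxx E1 E2 /= !eqxx /= /S3 S -catA.
Qed.

Lemma filled_past U e Y V : e.1 \notin unzip1 Y ->
  filled h (U ++ e :: Y ++ V) = filled h (U ++ Y ++ e :: V).
Proof.
elim: Y U => //= e' Y IH U; rewrite inE negb_or => /andP[ne nY].
by rewrite filled_comm // -cat_rcons IH // cat_rcons.
Qed.

(** A crossing by the particle, which goes from content 1 to content 0,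
    followed by one by the next particle, which goes from content 0 to content
    1.  The latter becomes primed since the particle in front of it now has a
    smaller content. *)
Lemma S4_step X Y1 f ys Z :
  let W := rcons X (0, (a, f)) ++ Y1 ++ (1, (a, false)) :: labelled b (0 :: ys) [::] ++ Z in
  valid h (unzip1 W) -> (forall q, isSome (filled h W q) -> in_shape la q) ->
  letters a X -> letters b Y1 -> letters a Z ->
  behind a h (rcons X (0, (a, f)))
    (cell (grown h (unzip1 (rcons X (0, (a, f)) ++ Y1))) 1) false ->
  vee (0 :: ys) -> 0 \notin unzip1 Y1 ->
  switch_step la a b (filled h W) =
  filled h (X ++ Y1 ++ [:: (0, (b, false)), (1, (a, true)), (0, (a, f))
                   & labelled b ys [::] ++ Z]).
Proof.
move=> W v dom lX lY1 lZ bX vy n0.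
have lX' : letters a (rcons X (0, (a, f))).
  by rewrite -cats1 letters_cat lX /= eqxx.
rewrite /switch_step (chosen_adj ab v dom) //.
have n1 : 1 \notin unzip1 Y1.
  move: v; rewrite /W cat_rcons unzip1_cat valid_cat => /andP[_].
  rewrite /= unzip1_cat /= -cat_rcons => /valid_gap[].
    by rewrite mem_rcons inE.
  by rewrite -cats1 cnt_cat /= => n _; apply/count_memPn; move: n; rewrite /cnt /=; lia.
set W' := (X ++ Y1) ++ [:: (0, (a, f)), (1, (a, false)), (0, (b, false))
  & labelled b ys [::] ++ Z].
have WE : filled h W = filled h W'.
  by rewrite /W cat_rcons filled_past //= desc0 /W' -catA.
have v' : valid h (unzip1 W').
  move: v; rewrite /W /W' cat_rcons -!catA !unzip1_cat /= !unzip1_cat /= valid_past ?unzip1_cat //.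
  apply/allP => y yY; rewrite /adj /=; case: y yY => [|[|y]] // yY.
  by rewrite yY in n1.
have [G1 E0 E1 E2 S] := diagonal_triple (a, true) v'.
set r := grown _ _ 0 in G1 E0 E1 E2 S.
have pE : cell (grown h (unzip1 (rcons X (0, (a, f)) ++ Y1))) 1 = (r, r.+1).
  rewrite /cell; suff -> : grown h (unzip1 (rcons X (0, (a, f)) ++ Y1)) 1 = r.
    by rewrite addn1.
  by rewrite -G1 cat_rcons !grownE !unzip1_cat /= !cnt_cat cnt_cons.
have br := state_b_right ab v (letters_labelled _ _ _) lZ.
have right := state_right v.
rewrite pE in br right *.
rewrite /switch_at {1}/S3_applies [r.+1 == r]eqn_leq ltnn /=.
have pat : S4_S7_pattern a b (filled h W) (r, r.+1).
  by rewrite /S4_S7_pattern WE eqxx E1 E0 E2 /= !eqxx.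
rewrite /S4_applies /S7_applies pat /=; case: ifP => [_|].
  by rewrite /S4_S7 WE S -catA.
move/negbT; rewrite negb_or negbK br => /andP[in2]; rewrite unzip1_labelled in in2; case/negP.
set L := labelled b (0 :: ys) [::] in right br *.
have in2' : 2 \in unzip1 L by rewrite unzip1_labelled.
rewrite right first_label_cat in2'; move/first_label_in: (in2') => [w1 [[i g] [w2 [wE _ fE]]]].
have ib : i = b.
  have : letters b L by apply: letters_labelled.
  by rewrite wE letters_cat /= => /and3P[_ /eqP].
move: fE; rewrite ib; case: g {wE} => [|-> //].
by rewrite /L => /(vee_primed vy).
Qed.

End Special.

(** * One letter passes through the other strip *)

Lemma filled_dom h w w' q : unzip1 w = unzip1 w' -> isSome (filled h w q) = isSome (filled h w' q).
Proof.
elim: w w' h => [|e w IH] [|e' w'] h //= [-> /IH E].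
by case: ifP => // _; rewrite E.
Qed.

(** If two boxes are added one after the other on neighbouring diagonals, the
    second one is to the right of the first one or below it. *)
Lemma valid_cell h d : addable h d -> forall e, adj d e -> addable (grow h d) e ->
  ((cell h d).1 <= (cell h e).1) && ((cell h d).2 <= (cell h e).2).
Proof.
move=> ad e /adjP[] E; subst; rewrite /addable /grow /cell /= => *; last first.
  by move: ad; rewrite /addable; lia.
by move: ad; rewrite /addable /=; lia.
Qed.

Section Reach.
Variables (la : seq nat) (a b : nat).

Definition reach n S S' :=
  exists2 k, k <= n & iter k (switch_step la a b) S = S'.

Lemma reach_refl n S : reach n S S.
Proof. by exists 0. Qed.

Lemma reach_step n S S1 S2 :
  switch_step la a b S = S1 -> reach n S1 S2 -> reach n.+1 S S2.
Proof. by move=> E [k kn kE]; exists k.+1 => //; rewrite iterSr E. Qed.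

Lemma reach_trans n m S1 S2 S3 :
  reach n S1 S2 -> reach m S2 S3 -> reach (n + m) S1 S3.
Proof.
move=> [k kn <-] [j jm <-]; exists (j + k); last by rewrite iterD.
by rewrite addnC leq_add.
Qed.

Lemma reach_le n m S1 S2 : n <= m -> reach n S1 S2 -> reach m S1 S2.
Proof. by move=> nm [k kn E]; exists k => //; apply: leq_trans nm. Qed.

End Reach.

Section Passes.
Variables (la : seq nat) (a b : nat) (h : nat -> nat).
Hypothesis ab : a != b.
Hypothesis sh : profile h.

(** The letters [X] wait, [Y1] have been crossed by the particle [x], [ys] are
    still in front of it, and [Z] have finished. *)
Definition word_of X Y1 x l ys Z : seq (nat * letter) :=
  X ++ Y1 ++ (x, (a, l)) :: labelled b ys [::] ++ Z.

Record state X Y1 x l ys Z : Prop := {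
  st_valid : valid h (unzip1 (word_of X Y1 x l ys Z));
  st_dom : forall q, isSome (filled h (word_of X Y1 x l ys Z) q) -> in_shape la q;
  st_X : letters a X;
  st_Y : letters b Y1;
  st_Z : letters a Z;
  st_behind : behind a h X (cell (grown h (unzip1 (X ++ Y1))) x) l;
  st_vee : vee ys
}.

Lemma unzip1_word X Y1 x l ys Z : unzip1 (word_of X Y1 x l ys Z) =
  unzip1 X ++ unzip1 Y1 ++ x :: ys ++ unzip1 Z.
Proof. by rewrite /word_of !unzip1_cat /= unzip1_cat unzip1_labelled. Qed.

Lemma state_valid_tail X Y1 x l ys Z : state X Y1 x l ys Z ->
  valid (grown h (unzip1 (X ++ Y1))) (x :: ys).
Proof.
move=> /st_valid; rewrite unzip1_word catA -cat_cons valid_cat => /andP[_].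
by rewrite valid_cat unzip1_cat => /andP[].
Qed.

Lemma state_far X Y1 x l y ys Z m : ~~ adj x y ->
  state X Y1 x l (y :: ys) Z ->
  filled h (word_of X Y1 x l (y :: ys) Z) =
    filled h (word_of X (rcons Y1 (y, (b, desc y ys))) x l ys Z) /\
  state X (rcons Y1 (y, (b, m))) x l ys Z.
Proof.
move=> xy st; have xney := valid_neq (state_valid_tail st).
have FE : filled h (word_of X Y1 x l (y :: ys) Z) =
    filled h (word_of X (rcons Y1 (y, (b, desc y ys))) x l ys Z).
  by rewrite /word_of cat_rcons catA /= filled_comm //= cats0 -catA.
split=> //; case: st => v dom lX lY lZ bX /andP[vy _]; split=> //.
- move: v; rewrite !unzip1_word -cats1 unzip1_cat -!catA /=.
  by rewrite 2!(catA (unzip1 X)) !(valid_cat _ (_ ++ _)) (valid_swap _ _ xy).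
- move=> q; rewrite (@filled_dom _ _ (word_of X (rcons Y1 (y, (b, desc y ys))) x l ys Z)).
    by rewrite -FE; apply: dom.
  by rewrite !unzip1_word -!cats1 !unzip1_cat.
- by rewrite -cats1 letters_cat lY /= eqxx.
by rewrite -cats1 catA unzip1_cat grown_cat /= cell_grow // eq_sym.
Qed.

Lemma state_adj X Y1 x l y ys Z m : adj x y ->
  state X Y1 x l (y :: ys) Z -> state X (rcons Y1 (x, (b, m))) y l ys Z.
Proof.
move=> xy st; have xney := valid_neq (state_valid_tail st).
have vt := state_valid_tail st.
case: st => v dom lX lY lZ bX /andP[vy _].
have uE : unzip1 (word_of X Y1 x l (y :: ys) Z) =
    unzip1 (word_of X (rcons Y1 (x, (b, m))) y l ys Z).
  by rewrite !unzip1_word -cats1 unzip1_cat -!catA.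
split=> //.
- by rewrite -uE.
- by move=> q; rewrite -(filled_dom _ _ uE); apply: dom.
- by rewrite -cats1 letters_cat lY /= eqxx.
rewrite -cats1 catA unzip1_cat grown_cat /= cell_grow //.
case/and3P: vt => ad ad' _; have /andP[c1 c2] := valid_cell ad xy ad'.
move=> X1 d l' X2 XE; move: (bX _ _ _ _ XE); case: l {bX v dom uE}.
  by case/andP=> -> /leq_trans -> .
by case/orP=> [->//|] /leq_trans -> //; rewrite orbT.
Qed.

Lemma state_fars X Y1 x l R L ys Z : all (fun y => ~~ adj x y) R ->
  unzip1 L = R -> letters b L -> state X Y1 x l (R ++ ys) Z ->
  state X (Y1 ++ L) x l ys Z.
Proof.
elim: R L Y1 => [|y R IH] [|[y' [b' m]] L] Y1 //=; first by rewrite cats0.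
move=> /andP[xy aR] [-> uL] /andP[/= /eqP -> lL] /(state_far m xy) [_ st].
by rewrite -cat_rcons; apply: IH st.
Qed.

Lemma pass_braid g ys : vee (0 :: ys) -> valid g (1 :: 0 :: ys) ->
  pass 0 ys = (ys, 0).
Proof.
move=> vy v; apply/pass_id; apply: sub_all (vee_after_braid vy v) => t.
by rewrite /adj; lia.
Qed.

(** Suppose that a waiting letter of content 0 occupied the box to the left of
    the particle.  By hypothesis an unprimed letter of positive content waits
    behind it; its column is at least that of the particle, which contradicts
    the order of the unprimed boxes. *)
Lemma corner_not_a X Y1 ys Z :
  state X Y1 1 false (0 :: ys) Z ->
  (forall X1 f X2, X = X1 ++ (0, (a, f)) :: X2 ->
    exists X3 d, X2 = rcons X3 (d, (a, false)) /\ 0 < d) ->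
  let r := (cell (grown h (unzip1 (X ++ Y1))) 1).1 in
  ~~ has_letter a (filled h (word_of X Y1 1 false (0 :: ys) Z) (r, r)).
Proof.
move=> st nX; set r := (cell _ _).1; move=> /=.
have vt := state_valid_tail st; case: st => v dom lX lY lZ bX vy.
have H0 : grown h (unzip1 (X ++ Y1)) 0 = r.+1.
  by case/and3P: vt => /andP[/= /eqP].
have N V : filled (grown h (unzip1 (X ++ Y1))) V (r, r) = None.
  by rewrite -{2}(addn0 r) filled_None_lt ?H0.
rewrite /word_of catA filled_cat N filled_cat; case Xr: (filled h X (r, r)) => [[i f]|]; last first.
  case Yr: (filled _ Y1 _) => [[i f]|] //; have [u [d [w [YE _]]]] := filled_some Yr.
  move: lY; rewrite YE letters_cat /= => /and3P[_ /eqP -> _].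
  by rewrite eq_sym.
apply/negP => /= /eqP ia; subst i.
have [X1 [d [X2 [XE]]]] := filled_some Xr; rewrite /cell => -[rE1 rE2].
have d0 : d = 0 by apply/eqP; rewrite -(eqn_add2l (grown h (unzip1 X1) d)) addn0 -rE2 -rE1.
subst d; have [X3 [d [X2E d0]]] := nX _ _ _ XE.
have XE' : X = (X1 ++ (0, (a, f)) :: X3) ++ [:: (d, (a, false))].
  by rewrite XE X2E -cats1 -catA.
have /= := bX _ _ _ _ XE'; rewrite -/r addn1 ltnS leqNgt => /negP; apply.
set X4 := X1 ++ _.
have [v4 v1] : valid h (unzip1 X4) /\ addable (grown h (unzip1 X1)) 0.
  move: v; rewrite /word_of XE' unzip1_cat valid_cat unzip1_cat valid_cat.
  case/andP => /andP[v4 _] _; split=> //; move: v4.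
  by rewrite /X4 unzip1_cat valid_cat => /and3P[].
have := shape_leD (shape_grown sh v4) d0; apply: leq_trans.
rewrite addn1 ltnS -[grown h (unzip1 (X ++ Y1)) 1]/r rE1; case/andP: v1 => _ /eqP <-.
by rewrite /X4 unzip1_cat grown_cat [X in _ <= X]grownE leq_addr.
Qed.

(** The whole passage of a particle, when the corner switch (S4) or (S7) does
    not interfere.  That switch needs an unprimed particle and a waiting letter of
    content 0 in the box to its left.  The hypothesis rules it out in two ways:
    either that letter is the last waiting one and the particle does not end
    with content 0, or [corner_not_a] applies. *)
Lemma pass_reach X Y1 x l ys Z : state X Y1 x l ys Z ->
  (l = false -> forall X1 f X2, X = X1 ++ (0, (a, f)) :: X2 ->
    X2 = [::] /\ (pass x ys).2 != 0 \/
    exists X3 d, X2 = rcons X3 (d, (a, false)) /\ 0 < d) ->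
  reach la a b (size ys) (filled h (word_of X Y1 x l ys Z))
    (filled h (X ++ Y1 ++ labelled b (pass x ys).1 [::] ++ ((pass x ys).2, (a, l)) :: Z)).
Proof.
have [n] := ubnP (size ys); elim: n => // n IHn in Y1 x ys *; rewrite ltnS.
have IH Y x' ys' := @IHn Y x' ys'.
case: ys => [|y ys] sn st nS; first exact: reach_refl.
have vt := state_valid_tail st.
rewrite /=; case: (boolP (adj x y)) => xy /=; last first.
  have [FE st'] := state_far (desc y ys) xy st.
  rewrite cats0 (desc_pass_far xy vt) FE; apply: (@reach_le _ _ _ (size ys)) => //.
  have := IH _ _ _ sn st'; rewrite cat_rcons; apply.
  by move=> l0 X1 f X2 XE; have := nS l0 _ _ _ XE; rewrite /= (negbTE xy).
have [/and3P[/eqP x0 /eqP y1 d]|n3] := boolP [&& x == 0, y == 1 & desc 1 ys].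
  (* The word 0 1 0: one switch (S3) accounts for two crossings. *)
  subst x y; case: ys d sn st nS {vt} => [|z ys] // d sn st nS.
  have z0 : z = 0 by move: d; rewrite /= ltnS leqn0 => /eqP.
  subst z; have vt := state_valid_tail st.
  have [v dom lX lY lZ bX vy] := st.
  have a01 : adj 0 1 by []. have a10 : adj 1 0 by [].
  have st' := state_adj false a10 (state_adj false a01 st).
  have E := S3_step ab v dom lX lY lZ bX vy.
  apply: (@reach_le _ _ _ (size ys).+1) => //; apply: reach_step E _.
  have /IH : size ys < n by apply: leq_trans sn.
  move/(_ _ _ st' nS); rewrite !cat_rcons.
  rewrite /= cats0.
  have -> : desc 1 (pass 0 ys).1 = false.
    have vy0 : vee (0 :: ys) by case/andP: vy.
    have := vee_after_braid vy0 (valid_tail vt).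
    case: (ys) => //= t s /andP[t1 _]; rewrite /adj; case: ifP => //=; lia.
  by rewrite /word_of !cat_rcons.
have [v dom lX lY lZ bX vy] := st.
have st' := state_adj (desc y ys) xy st.
apply: (@reach_step _ _ _ (size ys)).
  apply: (normal_step ab v) => // x1 y0 l0; subst x y l.
  apply: corner_not_a st _ => X1 f X2 XE.
  case: (nS erefl _ _ _ XE) => [[_]|//].
  by rewrite /= (pass_braid vy vt).
rewrite cats0 (desc_pass_near xy vt n3).
have := IH _ _ _ sn st'; rewrite /word_of !cat_rcons; apply.
by move=> l0 X1 f X2 XE; have := nS l0 _ _ _ XE; rewrite /= xy.
Qed.

(** The passage of a particle up to the corner switch.  At that moment the next
    particle has virtually crossed the letters [R], none of which is adjacent
    to it. *)
Lemma pass_reach_corner X Y1 x f ys Z :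
  state (rcons X (0, (a, f))) Y1 x false ys Z ->
  0 < x -> (pass x ys).2 = 0 -> 0 \notin unzip1 Y1 ->
  exists R ys', [/\ (pass x ys).1 = R ++ 1 :: ys', 0 \notin R,
    all (fun y => 1 < y) ys' &
    reach la a b (size R).+1
      (filled h (word_of (rcons X (0, (a, f))) Y1 x false ys Z))
      (filled h (X ++ Y1 ++ labelled b R (1 :: ys') ++
        [:: (0, (b, false)), (1, (a, true)), (0, (a, f)) & labelled b ys' [::] ++ Z]))].
Proof.
elim: ys Y1 x => [|y ys IH] Y1 x st x0 /=; first by move=> E; rewrite E in x0.
have vt := state_valid_tail st.
case: (boolP (adj x y)) => xy /= p0 n0; last first.
  have [FE st'] := state_far (desc y ys) xy st.
  have y0 : y != 0.
    apply/eqP => y0; subst y; have := mem_pass2 x ys; rewrite p0 inE eq_sym.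
    rewrite (gtn_eqF x0) /= => y0.
    have /(order_path_min ltn_trans)/allP/(_ _ y0) // := vee0 (st_vee st).
  have [|R [ys' [E R0 a1 re]]] := IH _ _ st' x0 p0.
    by rewrite -cats1 unzip1_cat mem_cat inE negb_or n0 eq_sym.
  exists (y :: R), ys'; split=> //; first by rewrite E.
    by rewrite inE negb_or eq_sym y0.
  apply: (@reach_le _ _ _ (size R).+1) => //.
  rewrite FE; move: re; rewrite cat_rcons.
  have <- : desc y (pass x ys).1 = desc y ys by apply: desc_pass_far vt.
  by rewrite E.
have [y0|y0] := eqVneq y 0.
  have x1 : x = 1 by case: (adjP xy); rewrite y0.
  subst x y; have [v dom lX lY lZ bX vy] := st.
  have pE := pass_braid vy vt.
  (* The particle is at the corner; it will meet no further letter. *)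
  exists [::], ys; split=> //; first by rewrite pE.
    exact: vee_after_braid vy vt.
  have lX' : letters a X by move: lX; rewrite -cats1 letters_cat => /andP[].
  exact: reach_step (S4_step ab v dom lX' lY lZ bX vy n0) (reach_refl _ _ _ _ _).
have [v dom lX lY lZ bX vy] := st.
have st' := state_adj (desc y ys) xy st.
have n3 : ~~ [&& x == 0, y == 1 & desc 1 ys] by rewrite (gtn_eqF x0).
have y0' : 0 < y by rewrite lt0n.
have [|R [ys' [E R0 a1 re]]] := IH _ _ st' y0' p0.
  by rewrite -cats1 unzip1_cat mem_cat inE negb_or n0 eq_sym -lt0n.
exists (x :: R), ys'; split=> //; first by rewrite E.
  by rewrite inE negb_or eq_sym -lt0n x0.
apply: (@reach_step _ _ _ (size R).+1).
  by apply: (normal_step ab v) => // _ yz; rewrite yz in y0.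
move: re; rewrite /word_of !cat_rcons /= -E (desc_pass_near xy vt n3).
by [].
Qed.

End Passes.

(** * The whole switching process *)

Lemma vee_catr u v : vee (u ++ v) -> vee v.
Proof. by elim: u => //= c u IH /andP[/IH]. Qed.

Lemma vee_catl u v : vee (u ++ v) -> vee u.
Proof.
elim: u => //= c u IH /andP[/IH -> /=]; case: u {IH} => //= d u.
by case/orP=> [->//|/andP[-> p]];
  rewrite (cat_path ltn d u v) in p; case/andP: p => ->; rewrite orbT.
Qed.

Lemma vee_rcons w x : vee (rcons w x) -> vee w.
Proof. by rewrite -cats1; apply: vee_catl. Qed.

Lemma gtn_cons c w : path gtn c w = (if w is d :: _ then d < c else true) && sorted gtn w.
Proof. by case: w. Qed.

(** A descent at the end forbids any ascent before it. *)
Lemma vee_last_desc w u x : vee (rcons (rcons w u) x) -> x < u ->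
  sorted gtn (rcons (rcons w u) x).
Proof.
move=> + xu; elim: w => [_|c w IH] /=; first by rewrite andbT.
case/andP=> /IH s; rewrite gtn_cons s andbT.
case: w {IH s} => [|d w] /=; first by case/orP => // /and3P[_]; rewrite ltnNge ltnW.
case/orP => // /andP[_]; rewrite -!cats1 -catA cat_path /= => /and4P[_ _].
by rewrite ltnNge ltnW.
Qed.

Lemma vee_last0 w : vee (rcons w 0) -> sorted gtn (rcons w 0).
Proof.
case/lastP: w => // w u v; case: (ltnP 0 u) => [|u0]; first exact: vee_last_desc.
move: u0; rewrite leqn0 => /eqP u0; subst u.
by move: v; rewrite -!cats1 -catA => /vee_catr.
Qed.

Lemma labelled_rcons i u d t : labelled i (rcons u d) t =
  rcons (labelled i u (d :: t)) (d, (i, desc d t)).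
Proof. by rewrite -!cats1 labelled_cat. Qed.

Lemma labelled_split i xs t X1 d l X2 : labelled i xs t = X1 ++ (d, l) :: X2 ->
  exists w, [/\ xs = unzip1 X1 ++ d :: w, l = (i, desc d (w ++ t)) & X2 = labelled i w t].
Proof.
elim: X1 xs => [|e X1 IH] [|c xs] //=.
  by case=> <- <- <-; exists xs.
by case=> <- /IH [w [-> -> ->]]; exists w.
Qed.

(** No content lies strictly between 0 and 1. *)
Lemma labelled_zero_one i R t t' : 0 \notin R -> 1 \notin R ->
  labelled i R (1 :: t) = labelled i R (0 :: t').
Proof.
elim: R => //= c R IH; rewrite !inE !negb_or => /andP[c0 R0] /andP[c1 R1].
rewrite IH //; case: R {IH R0 R1} => //=; congr (cons (_, (_, _)) _).
by move: c0 c1; lia.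
Qed.

Lemma pass_cat x ys zs : pass x (ys ++ zs) =
  ((pass x ys).1 ++ (pass (pass x ys).2 zs).1, (pass (pass x ys).2 zs).2).
Proof.
elim: ys x => [|y ys IH] x /=; first by case: pass.
by case: ifP => _; rewrite IH.
Qed.

Lemma labelled_head i xs u t t' : labelled i xs (u :: t) = labelled i xs (u :: t').
Proof. by elim: xs => //= c [|d xs] ->. Qed.

(** The boxes of a filling depend on the contents alone. *)
Fixpoint occupied (h : nat -> nat) (w : seq nat) (q : box) : bool :=
  if w is d :: w' then (q == cell h d) || occupied (grow h d) w' q else false.

Lemma filled_occupied h w q : isSome (filled h w q) = occupied h (unzip1 w) q.
Proof. by elim: w h => //= e w IH h; case: ifP => //= _; rewrite IH. Qed.

Lemma occupied_cat h w1 w2 q :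
  occupied h (w1 ++ w2) q = occupied h w1 q || occupied (grown h w1) w2 q.
Proof. by elim: w1 h => //= d w1 IH h; rewrite IH orbA. Qed.

Lemma occupied_swap h d e w q : occupied h (d :: e :: w) q = occupied h (e :: d :: w) q.
Proof.
have [->//|de] := eqVneq d e.
by rewrite /= growC !cell_grow // 1?eq_sym // orbCA.
Qed.

Lemma occupied_pass h x ys w q :
  occupied h ((pass x ys).1 ++ (pass x ys).2 :: w) q = occupied h (x :: ys ++ w) q.
Proof.
elim: ys x h => //= y ys IH x h; case: ifP => xy /=; rewrite IH //.
exact: (occupied_swap h y x).
Qed.

Section Loop.
Variables (la : seq nat) (a b : nat) (h : nat -> nat).
Hypothesis ab : a != b.
Hypothesis sh : profile h.

(** The situation before the passage of [x]: the letters of [rcons xs x] are to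
    pass through [ys], and [zs] have done so.  The prime [l] of the particle is
    the one that it will have at the end, given by the contents after its
    passage; [start_next] shows that it is the initial one unless the corner
    switch has changed it. *)
Record start xs x l ys zs : Prop := {
  start_valid : valid h (xs ++ x :: ys ++ zs);
  start_xs : vee (rcons xs x);
  start_ys : vee ys;
  start_zs : vee ((pass x ys).2 :: zs);
  start_l : l = desc (pass x ys).2 zs;
  start_dec : l -> sorted gtn (rcons xs x)
}.

Definition start_word xs x l ys zs :=
  word_of a b (labelled a xs [:: x]) [::] x l ys (labelled a zs [::]).

Lemma start_neq xs x l ys zs u : start (rcons xs u) x l ys zs ->
  [/\ u != x, (pass u (pass x ys).1).2 != (pass x ys).2 &
    exists g, valid g (u :: x :: ys)].
Proof.
case=> v _ _ _ _ _; move: (v); rewrite cat_rcons valid_cat => /andP[_].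
rewrite -2!cat_cons valid_cat => /andP[v1 _]; split.
- exact: valid_neq v1.
- move: v; rewrite valid_cat valid_pass -valid_cat cat_rcons valid_cat.
  by case/andP=> _; rewrite valid_pass valid_cat => /andP[_ /valid_neq].
by exists (grown h xs).
Qed.

Lemma start_pass xs x l ys zs : start xs x l ys zs -> vee (pass x ys).1.
Proof.
case=> v _ vy _ _ _; move: v; rewrite valid_cat -cat_cons valid_cat.
by case/and3P => _ v _; apply: pass_vee vy v.
Qed.

(** By [desc_pass_pass] the initial prime of [u] is also the final one, unless
    [u] has content 0 and the particle [x] ends with content 0. *)
Lemma start_next xs u x l ys zs : start (rcons xs u) x l ys zs ->
  start xs u ((u == 0) && ((pass x ys).2 == 0) || (x < u))
    (pass x ys).1 ((pass x ys).2 :: zs).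
Proof.
move=> st; have [ux ux' [g vg]] := start_neq st.
case: st => v vx vy vz lE ld.
set x' := (pass x ys).2 in ux' vz lE *; set ys' := (pass x ys).1 in ux' *.
set u' := (pass u ys').2 in ux' *.
have pair : (x < u) = (x' < u') \/ u = 0 /\ x' = 0 := desc_pass_pass vy vg.
split.
- by move: v; rewrite valid_cat valid_pass -valid_cat cat_rcons.
- exact: vee_rcons vx.
- by apply: pass_vee vy _; apply: valid_tail vg.
- rewrite -/u'; case: (ltngtP x' u') => [lt|gt|E]; last by rewrite E eqxx in ux'.
    by apply/andP; split=> //; rewrite /= lt.
  apply/andP; split=> //; apply/orP; right; rewrite /= gt /=.
  have xu : ~~ (x < u).
    case: pair => [->|[_ x0]]; first by rewrite -leqNgt ltnW.
    by rewrite x0 in gt.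
  have l0 : desc x' zs = false.
    rewrite -lE; apply/negP => /ld; rewrite -!cats1 -catA.
    move/(subseq_sorted (rev_trans ltn_trans) (suffix_subseq _ _)) => /=.
    by rewrite andbT (negbTE xu).
  by move: vz => /andP[_]; rewrite l0.
- rewrite -/u' /=; case: pair => [->|[-> x0]].
    case: eqP => // u0; case: eqP => // x0; rewrite /= x0.
    by rewrite x0 in ux'; rewrite lt0n ux'.
  by rewrite x0 /= lt0n -x0 ux'.
case/orP=> [/andP[/eqP u0 _]|xu].
  by rewrite u0; apply: vee_last0; rewrite -u0; apply: vee_rcons vx.
have := vee_last_desc vx xu; rewrite -cats1.
by move/(subseq_sorted (rev_trans ltn_trans) (prefix_subseq _ _)).
Qed.

(** The letters before a primed letter of a vee-shaped word have larger
    contents, hence lie in higher rows; the unprimed letters before an unprimed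
    letter have smaller contents, hence lie in columns further to the left. *)
Lemma start_state xs x l ys zs : start xs x l ys zs ->
  (forall q, isSome (filled h (start_word xs x l ys zs) q) -> in_shape la q) ->
  state la a b h (labelled a xs [:: x]) [::] x l ys (labelled a zs [::]).
Proof.
case=> v vx vy vz lE ld dom; split=> //; try exact: letters_labelled.
  by rewrite unzip1_word !unzip1_labelled.
move=> X1 d l' X2 /labelled_split [w [xE [lE'] _]]; rewrite cats0 unzip1_labelled.
have gE : grown h (unzip1 X1) d < grown h xs d.
  by rewrite !grownE xE cnt_cat cnt_cons eqxx ltn_add2l -[X in X < _]addn0 ltn_add2l.
have sx : profile (grown h xs) by apply: shape_grown sh _; move: v; rewrite valid_cat => /andP[].
have vdw : vee (d :: rcons w x).
  by move: vx; rewrite xE rcons_cat => /vee_catr.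
case lb : l; last first.
  rewrite /= lE' cats1; case: (boolP (desc d (rcons w x))) => //= nd.
  move: vdw => /andP[_]; rewrite (negbTE nd) /= => /(order_path_min ltn_trans).
  rewrite all_rcons => /andP[/= /ltnW dx _].
  by have := shape_leD sx dx; rewrite /cell /=; clear -gE; lia.
have : sorted gtn (d :: rcons w x).
  move: (ld lb); rewrite xE rcons_cat rcons_cons.
  by move/(subseq_sorted (rev_trans ltn_trans) (suffix_subseq _ _)).
move=> p; apply/andP; split.
  by rewrite lE' cats1; case: (w) p => [|e t] /= /andP[].
move: p => /= /(order_path_min (rev_trans ltn_trans)); rewrite all_rcons => /andP[/= /ltnW xd _].
by have := shape_le sx xd; rewrite /cell /=; apply: leq_trans.
Qed.

Lemma start_dom xs u x l l2 ys zs zs' : zs' = (pass x ys).2 :: zs ->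
  (forall q, isSome (filled h (start_word (rcons xs u) x l ys zs) q) -> in_shape la q) ->
  forall q, isSome (filled h (start_word xs u l2 (pass x ys).1 zs') q) -> in_shape la q.
Proof.
move=> -> dom q; rewrite filled_occupied /start_word unzip1_word !unzip1_labelled /= => o.
apply: dom; rewrite filled_occupied /start_word unzip1_word !unzip1_labelled /=.
rewrite cat_rcons occupied_cat -[u :: x :: _]cat1s occupied_cat.
by rewrite -occupied_pass -occupied_cat -occupied_cat.
Qed.

Lemma start_plain xs u x l ys zs : start (rcons xs u) x l ys zs ->
  (forall q, isSome (filled h (start_word (rcons xs u) x l ys zs) q) -> in_shape la q) ->
  ~~ ((u == 0) && ((pass x ys).2 == 0)) ->
  reach la a b (size ys) (filled h (start_word (rcons xs u) x l ys zs))
    (filled h (start_word xs u (x < u) (pass x ys).1 ((pass x ys).2 :: zs))).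
Proof.
move=> st dom ne; have S0 := start_state st dom; have [ux _ _] := start_neq st.
have := pass_reach ab sh S0; rewrite /start_word /word_of /=.
rewrite labelled_rcons !cat_rcons cats0 -(start_l st) (@labelled_head _ _ _ _ [::]).
apply.
move=> l0 X1 f X2; rewrite -(@labelled_head a xs u [:: x] [::]) -labelled_rcons.
move=> /labelled_split [w [wE [fE] ->]].
move: (start_xs st); rewrite {1}wE rcons_cat rcons_cons => /vee_catr /vee0 p.
case/lastP: w wE fE p => [|w d] wE fE p.
  left; split=> //; move: wE; rewrite cats1 => /rcons_inj [_ uE].
  by move: ne; rewrite uE.
right; exists (labelled a w [:: d; x]), d; rewrite labelled_rcons.
move: p; rewrite -!cats1 -catA -[sorted _ _]/(path ltn 0 (w ++ [:: d; x])) cat_path /= => /and4P[p].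
case: (ltnP x d) => [xd _ dx|_ d0 _ _]; first by move: (ltn_trans dx xd); rewrite ltnn.
by split=> //; apply: leq_ltn_trans d0.
Qed.

(** Here the passages of [x] and of the next particle are merged: the corner
    switch brings the latter, now primed, directly to the box of content 1. *)
Lemma start_corner xs x l ys zs : start (rcons xs 0) x l ys zs ->
  (forall q, isSome (filled h (start_word (rcons xs 0) x l ys zs) q) -> in_shape la q) ->
  (pass x ys).2 = 0 ->
  reach la a b (size ys + size ys) (filled h (start_word (rcons xs 0) x l ys zs))
    (filled h (labelled a xs [:: 0] ++ labelled b (pass 0 (pass x ys).1).1 [::] ++
          labelled a [:: (pass 0 (pass x ys).1).2, 0 & zs] [::])).
Proof.
move=> st dom p0; have S0 := start_state st dom; have [ux _ _] := start_neq st.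
have x0 : 0 < x by rewrite lt0n eq_sym.
have l0 : l = false.
  apply/negP => /(start_dec st); rewrite -!cats1 -catA.
  by move/(subseq_sorted (rev_trans ltn_trans) (suffix_subseq _ _)).
subst l; have st' := start_next st; rewrite p0 !eqxx /= in st'.
have S1 := start_state st' (start_dom (esym (congr1 (cons^~ zs) p0)) dom).
have lE := start_l st'.
have := S0; rewrite labelled_rcons => /(pass_reach_corner ab) /(_ x0 p0 isT).
move=> [R [ys' [E R0 a1]]].
have ys0 : 0 \notin (pass x ys).1.
  rewrite E mem_cat inE !negb_or R0 /=; apply/negP => /(allP a1); by [].
have R1 : 1 \notin R.
  have := start_valid st'; rewrite valid_cat => /andP[_] /(valid_gap ys0)[+ _].
  rewrite E cnt_cat cnt_cons eqxx => c; apply/count_memPn.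
  by move: c; rewrite /cnt; clear; lia.
have nR : all (fun y => ~~ adj 0 y) R.
  apply/allP => y yR; rewrite /adj /=; apply/negP => /eqP y1; subst y.
  by rewrite yR in R1.
have sE : size (pass x ys).1 = size R + (size ys').+1 by rewrite E size_cat.
have lsE : size ys = size R + (size ys').+1 by rewrite -sE size_pass.
rewrite E in S1 lE *.
have a01 : adj 0 1 by [].
have S2 := state_adj false a01
  (state_fars nR (unzip1_labelled b R (1 :: ys')) (letters_labelled _ _ _) S1).
have := pass_reach ab sh S2; move=> re2 re1.
have {}re2 := re2 (fun e => False_ind _ (notF (esym e))).
have pE : pass 0 (R ++ 1 :: ys') = (R ++ 0 :: (pass 1 ys').1, (pass 1 ys').2).
  by rewrite pass_cat pass_id.
rewrite pE /= in lE *.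
apply: (@reach_le _ _ _ ((size R).+1 + size ys')); first by rewrite lsE; lia.
have -> : labelled b (R ++ 0 :: (pass 1 ys').1) [::] =
    labelled b R (1 :: ys') ++ (0, (b, false)) :: labelled b (pass 1 ys').1 [::].
  by rewrite labelled_cat /= cats0 desc0 (@labelled_zero_one _ _ ys' (pass 1 ys').1).
rewrite -labelled_rcons in re1; apply: (reach_trans re1).
move: re2; rewrite /word_of /= -cats1 -!catA /= cats0 -lE.
rewrite (@labelled_head a xs 0 [:: x] [::]) ltn0 desc0.
(* The finished letter of content 0 is moved behind [ys'], whose contents are
   larger than 1. *)
set U := [:: (0, (b, false)); (1, (a, true))].
have := @filled_past h (labelled a xs [:: 0] ++ labelled b R (1 :: ys') ++ U) (0, (a, false))
  (labelled b ys' [::]) (labelled a zs [::]).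
rewrite -!catA /= unzip1_labelled => -> //; apply/negP => /(allP a1); by [].
Qed.

(** One letter passes at a time, or two when the corner switch occurs. *)
Lemma loop xs x l ys zs : start xs x l ys zs ->
  (forall q, isSome (filled h (start_word xs x l ys zs) q) -> in_shape la q) ->
  let r := infuse (rcons xs x) ys in
  [/\ reach la a b ((size xs).+1 * size ys) (filled h (start_word xs x l ys zs))
        (filled h (labelled b r.1 [::] ++ labelled a (r.2 ++ zs) [::])),
      vee r.1 & vee (r.2 ++ zs)].
Proof.
have [n] := ubnP (size xs); elim: n => // n IH in xs x l ys zs *; rewrite ltnS.
case/lastP: xs => [|xs u] sn st dom r.
  have -> : r = ((pass x ys).1, [:: (pass x ys).2]) by [].
  split; [|exact: start_pass st | exact: start_zs st].
  have := pass_reach ab sh (start_state st dom); rewrite mul1n.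
  have -> : labelled a ([:: (pass x ys).2] ++ zs) [::] =
      ((pass x ys).2, (a, l)) :: labelled a zs [::].
    by rewrite /= cats0 -(start_l st).
  by apply => _ [].
rewrite size_rcons in sn.
have st' := start_next st.
rewrite /r infuse_rcons cat_rcons size_rcons {r}.
case: (boolP ((u == 0) && ((pass x ys).2 == 0))) => [/andP[/eqP u0 /eqP p0]|ne].
  (* Two letters have finished, so the induction hypothesis is applied to [xs]
     without its last letter. *)
  subst u; have re := start_corner st dom p0.
  rewrite p0 !eqxx /= in st'.
  have dom' := start_dom (l2 := true) (esym (congr1 (cons^~ zs) p0)) dom.
  case/lastP: xs => [|xs t] in sn st dom st' re dom' *.
    rewrite p0; split.
    - by rewrite mul2n -addnn.
    - exact: start_pass st'.
    - exact (start_zs st').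
  have st2 := start_next st'; have [t0 _ _] := start_neq st'.
  rewrite (negbTE t0) /= in st2.
  rewrite size_rcons in sn.
  have [||re2 v1 v2] := IH _ _ _ _ _ _ st2; first exact: ltn_trans sn.
    by apply: start_dom dom'.
  rewrite infuse_rcons cat_rcons p0; split=> //.
  rewrite size_rcons; move: re2; rewrite size_pass size_pass => re2.
  apply: (@reach_le _ _ _ (size ys + size ys + (size xs).+1 * size ys)); first by lia.
  apply: (reach_trans re); move: re2.
  by rewrite /start_word /word_of labelled_rcons cat_rcons (@labelled_head a xs t [:: 0] [::]).
have re := start_plain st dom ne; rewrite (negbTE ne) /= in st'.
have dom' := start_dom (l2 := x < u) erefl dom.
have [re' v1 v2] := IH _ _ _ _ _ sn st' dom'.
split=> //; rewrite mulSn; apply: (reach_trans re).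
by rewrite -[X in _ * X](size_pass x ys).
Qed.

End Loop.

(** * The Bender-Knuth operators on pairs of strips *)

Fixpoint cells (h : nat -> nat) (w : seq nat) : seq box :=
  if w is d :: w' then cell h d :: cells (grow h d) w' else [::].

Lemma mem_cells h w q : (q \in cells h w) = occupied h w q.
Proof. by elim: w h => //= d w IH h; rewrite inE IH. Qed.

Lemma occupied_below h w d r : r < h d -> occupied h w (r, r + d) = false.
Proof.
move=> rd; have := filled_occupied h [seq (c, (0, false)) | c <- w] (r, r + d).
by rewrite filled_None_lt // /unzip1 -map_comp map_id.
Qed.

Lemma cells_uniq h w : uniq (cells h w).
Proof.
elim: w h => //= d w IH h; rewrite IH mem_cells andbT.
by rewrite occupied_below // /grow eqxx addn1.
Qed.

Lemma size_reading_order la : size (reading_order la) = sumn la.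
Proof.
rewrite /reading_order size_flatten /shape -map_comp map_rev sumn_rev.
rewrite (eq_map (_ : _ =1 nth 0 la)); last by move=> r /=; rewrite size_map size_iota.
by rewrite map_nth_iota0 // take_size.
Qed.

(** The boxes drawn by a word are distinct. *)
Lemma size_dom la h w : (forall q, occupied h w q -> in_shape la q) -> size w <= sumn la.
Proof.
move=> dom; rewrite -size_reading_order.
have -> : size w = size (cells h w) by elim: w h {dom} => //= d w IH h; rewrite -IH.
apply: uniq_leq_size; first exact: cells_uniq.
by move=> q; rewrite mem_cells mem_reading_order; apply: dom.
Qed.

Section Switching.
Variables (la : seq nat) (a b : nat) (h : nat -> nat).
Hypothesis ab : a != b.
Hypothesis sh : profile h.

Lemma switch_step_settled Y Z : letters b Y -> letters a Z -> valid h (unzip1 (Y ++ Z)) ->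
  switch_step la a b (filled h (Y ++ Z)) = filled h (Y ++ Z).
Proof.
move=> lY lZ v; rewrite /switch_step chosen_none // => l q.
apply/negP => /andP[/eqP Sq nb].
case Yq: (filled h Y q) => [m|].
  have Em : m = (a, l) by move: Sq; rewrite filled_cat Yq => -[].
  move: Yq; rewrite Em => /filled_some [u [d [w [E _]]]].
  by move: lY; rewrite E letters_cat /= (negbTE ab) !andbF.
move: Sq; rewrite filled_cat Yq => /filled_some [u [d [w [E qE]]]].
apply: (@not_cand a b h ab (Y ++ u) d l w q).
- by move: v; rewrite E catA.
- by move: lZ; rewrite E letters_cat => /and3P[].
- by rewrite qE unzip1_cat grown_cat.
by move: nb; rewrite E catA.
Qed.

(** Each switch makes a letter of [xs] cross at least one letter of [ys], so
    [size xs * size ys] switches suffice, well below the prescribed number. *)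
Lemma switching_word xs ys : vee xs -> vee ys -> valid h (xs ++ ys) ->
  (forall q, occupied h (xs ++ ys) q -> in_shape la q) ->
  let r := infuse xs ys in
  [/\ iter (2 * sumn la ^ 2) (switch_step la a b)
        (filled h (labelled a xs [::] ++ labelled b ys [::])) =
      filled h (labelled b r.1 [::] ++ labelled a r.2 [::]), vee r.1 & vee r.2].
Proof.
move=> vx vy v dom r.
suff [re v1 v2] : [/\ reach la a b (size xs * size ys)
    (filled h (labelled a xs [::] ++ labelled b ys [::]))
    (filled h (labelled b r.1 [::] ++ labelled a r.2 [::])), vee r.1 & vee r.2].
  split=> //; case: re => k kn kE.
  have kN : k <= 2 * sumn la ^ 2.
    (* [size xs + size ys] is at most [sumn la]. *)
    apply: (leq_trans kn); have := size_dom dom; rewrite size_cat => s.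
    rewrite mul2n -addnn -[X in X <= _]addn0 leq_add // -mulnn leq_mul //; lia.
  rewrite -(subnK kN) iterD kE.
  elim: (_ - k) => //= n ->; apply: switch_step_settled; try exact: letters_labelled.
  rewrite unzip1_cat !unzip1_labelled.
  by move: v; rewrite -[xs ++ ys]cats0 -catA valid_infuse cats0.
rewrite /r {r}; case/lastP: xs vx v dom => [|xs x] vx v dom.
  split=> //=.
  by rewrite cats0; apply: reach_refl.
have st : start h xs x false ys [::].
  by split=> //; rewrite cats0 -cat_rcons.
have wE : start_word a b xs x false ys [::] =
    labelled a (rcons xs x) [::] ++ labelled b ys [::].
  by rewrite /start_word /word_of labelled_rcons cat_rcons cats0.
have dom' : forall q, isSome (filled h (start_word a b xs x false ys [::]) q) -> in_shape la q.
  by move=> q; rewrite wE filled_occupied unzip1_cat !unzip1_labelled; apply: dom.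
have [re v1 v2] := loop ab sh st dom'.
by rewrite wE cats0 in re; rewrite cats0 in v2; rewrite size_rcons.
Qed.

End Switching.

Definition two_strips (h : nat -> nat) (i : nat) (xs ys : seq nat) (T : filling) : Prop :=
  [/\ profile h, vee xs, vee ys, valid h (xs ++ ys) &
      union_filling (part T i) (part T i.+1) =
      filled h (labelled i xs [::] ++ labelled i.+1 ys [::])].

Definition canonical_within (la : seq nat) (T : filling) : Prop :=
  (forall x, isSome (T x) -> in_shape la x) /\ canonical_form la T.

(** The value of [BK la i T] in terms of the two strips. *)
Definition BK_filling h i xs ys (T : filling) : filling := fun x =>
  if has_letter i (T x) || has_letter i.+1 (T x)
  then filled h (labelled i (infuse xs ys).1 [::] ++ labelled i.+1 (infuse xs ys).2 [::]) x
  else T x.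

Lemma canonical_first la T : canonical_form la T <->
  forall i x, first_box la T i = Some x -> T x <> Some (i, true).
Proof.
have E i : ohead [seq l <- reading_word la T | l.1 == i] =
    obind T (first_box la T i).
  rewrite /reading_word /first_box; elim: (reading_order la) => //= x s IH.
  by case Tx: (T x) => [l|] //=; case: ifP => //= _; rewrite Tx.
split=> [c i x fx Tx|c i]; first by have := c i; rewrite E fx /= Tx eqxx.
rewrite E; case fx: (first_box la T i) => [x|] //=.
by apply/eqP; apply: c.
Qed.

Lemma canonicalize_id la T : canonical_form la T -> canonicalize la T = T.
Proof.
move=> /canonical_first c; apply: funext => x; rewrite /canonicalize.
case Tx: (T x) => [[i p]|] //; case: eqP => [/c|]; last by rewrite andbT.
by rewrite andbF; case: p Tx => // ->.
Qed.

Lemma two_strips_dom h i xs ys T x : two_strips h i xs ys T ->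
  has_letter i (T x) || has_letter i.+1 (T x) = occupied h (xs ++ ys) x.
Proof.
case=> _ _ _ _ E.
have := filled_occupied h (labelled i xs [::] ++ labelled i.+1 ys [::]) x.
rewrite -E unzip1_cat !unzip1_labelled => <-.
rewrite /union_filling /part; case: (has_letter i (T x)) / boolP => /=.
  by case: (T x).
by case: ifP => // ; case: (T x).
Qed.

Lemma occupied_infuse h xs ys w q :
  occupied h ((infuse xs ys).1 ++ (infuse xs ys).2 ++ w) q = occupied h (xs ++ ys ++ w) q.
Proof.
by elim: xs h => //= x xs IH h; rewrite occupied_pass /= IH.
Qed.

Lemma filled_letters h i k xs ys q j :
  has_letter j (filled h (labelled i xs [::] ++ labelled k ys [::]) q) -> (j == i) || (j == k).
Proof.
set W := _ ++ _; case Fq : (filled h W q) => [l|] //= /eqP <-.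
have [u [d [w [WE _]]]] := filled_some Fq.
suff : all (fun e => (e.2.1 == i) || (e.2.1 == k)) W.
  by rewrite WE all_cat /= => /and3P[].
rewrite /W all_cat; apply/andP; split.
  by apply: sub_all (letters_labelled i _ _) => e ->.
by apply: sub_all (letters_labelled k _ _) => e ->; rewrite orbT.
Qed.

Lemma primed_followed i k xs ys u d j v :
  labelled i xs [::] ++ labelled k ys [::] = u ++ (d, (j, true)) :: v ->
  exists e l v', v = (e, (j, l)) :: v' /\ e < d.
Proof.
elim: xs u => [|c xs IH] [|e0 u] //=.
- case: ys => [|c ys] //= -[-> -> dE <-].
  case: ys dE => [|e ys] //= ed.
  by do 3!eexists; split; [reflexivity|].
- move=> E; have [w [yE [-> dE] ->]] := @labelled_split k ys [::] (e0 :: u) d (j, true) v E.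
  case: w dE {yE} => [|e w] //= /esym ed.
  by do 3!eexists; split; [reflexivity|].
- case=> -> -> dE <-; case: xs dE {IH} => [|e xs] //= ed.
  by do 3!eexists; split; [reflexivity|].
by case=> _ /IH.
Qed.

Lemma ohead_filter_first (T : eqType) (R : rel T) (P : pred T) s x y :
  pairwise R s -> ohead [seq z <- s | P z] = Some x -> y \in s -> P y ->
  y = x \/ R x y.
Proof.
move=> /(subseq_pairwise (filter_subseq P s)) ps E ys Py.
have : y \in [seq z <- s | P z] by rewrite mem_filter Py.
case: [seq z <- s | P z] E ps => //= z t [->] /andP[/allP zt _].
by rewrite inE => /orP[/eqP|/zt]; [left|right].
Qed.

(** A primed letter is followed by a smaller content.  The box of that content
    lies in a lower row, so it is read earlier. *)
Lemma primed_not_first la h i k xs ys T j x :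
  let W := labelled i xs [::] ++ labelled k ys [::] in
  profile h -> valid h (xs ++ ys) ->
  (forall q, occupied h (xs ++ ys) q -> in_shape la q) ->
  (forall q, filled h W q -> T q = filled h W q) ->
  filled h W x -> first_box la T j = Some x -> T x <> Some (j, true).
Proof.
move=> W sh v dom TE Fx fx; rewrite TE // => Tx.
have [u [d [w [WE xE]]]] := filled_some Tx.
have [e [l [w' [wE ed]]]] := primed_followed WE; subst w.
have := v; rewrite -{1}[xs](unzip1_labelled i xs [::]) -{1}[ys](unzip1_labelled k ys [::]).
rewrite -unzip1_cat -/W WE unzip1_cat valid_cat => /andP[vu /= /andP[ad _]].
set G := grown h (unzip1 u) in xE ad *.
have sG : profile G by apply: shape_grown.
pose y := cell (grow G d) e.
have Fy : filled h W y = Some (j, l).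
  have := @filled_mid h (u ++ [:: (d, (j, true))]) (e, (j, l)) w'.
  by rewrite -catA unzip1_cat grown_cat -WE.
have yl : y \in reading_order la.
  by rewrite mem_reading_order; apply: dom;
    rewrite -{1}[xs](unzip1_labelled i xs [::]) -{1}[ys](unzip1_labelled k ys [::])
      -unzip1_cat -filled_occupied Fy.
have xy : x.1 < y.1.
  rewrite /y cell_grow ?xE; last by rewrite eq_sym (ltn_eqF ed).
  case: d ed ad {WE xE y Fy yl} => // d; rewrite ltnS => ed /andP[/= /eqP dE _].
  by have := shape_le sG ed; rewrite dE.
have := @ohead_filter_first _ read_before (fun z => has_letter j (T z)) _ x y
  (reading_order_pairwise la) fx yl.
rewrite TE Fy //= eqxx => /(_ isT) [yx|]; first by rewrite yx ltnn in xy.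
by rewrite /read_before => /orP[|/andP[/eqP E _]]; [rewrite ltnNge ltnW | rewrite E ltnn in xy].
Qed.

(** Exchanging the labels turns the switched pair into a pair of strips of the
    original form. *)
Lemma filled_exchange i h xs ys :
  exchange_labels i (filled h (labelled i.+1 xs [::] ++ labelled i ys [::])) =
  filled h (labelled i xs [::] ++ labelled i.+1 ys [::]).
Proof.
have exch w g k k' V V' :
    (if k == i then i.+1 else if k == i.+1 then i else k) = k' ->
    (forall g, exchange_labels i (filled g V) = filled g V') ->
    exchange_labels i (filled g (labelled k w [::] ++ V)) = filled g (labelled k' w [::] ++ V').
  move=> kE VE; elim: w g => //= c w IH g; apply: funext => x.
  move: (congr1 (fun f => f x) (IH (grow g c))); rewrite /exchange_labels /=.
  by case: ifP => // _ _; rewrite kE.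
apply: (exch xs) => [|g]; first by rewrite eqxx gtn_eqF.
rewrite -[labelled i _ _]cats0 -[labelled i.+1 _ _]cats0.
apply: (exch ys g i i.+1) => [|g']; first by rewrite eqxx.
exact: funext.
Qed.

Section BK.
Variables (la : seq nat) (i : nat) (T : filling).
Hypothesis gT : canonical_within la T.
Variables (h : nat -> nat) (xs ys : seq nat).
Hypothesis sT : two_strips h i xs ys T.

(** Since [infuse] produces vee-shaped words with their canonical labels, the
    canonicalization has nothing left to do. *)
Lemma BK_two_strips :
  [/\ BK la i T = BK_filling h i xs ys T, canonical_within la (BK_filling h i xs ys T) &
      two_strips h i (infuse xs ys).1 (infuse xs ys).2 (BK_filling h i xs ys T)].
Proof.
have [domT canT] := gT; have [sh vx vy v E] := sT.
have domW q : occupied h (xs ++ ys) q -> in_shape la q.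
  rewrite -(two_strips_dom q sT) => o; apply: domT; move: o.
  by case: (T q).
have ii : i != i.+1 by rewrite ltn_eqF.
have [itE v1 v2] := switching_word ii sh vx vy v domW.
set r := infuse xs ys in itE v1 v2 *; set T1 := BK_filling _ _ _ _ _.
set W := labelled i r.1 [::] ++ labelled i.+1 r.2 [::].
have occE q : isSome (filled h W q) = occupied h (xs ++ ys) q.
  rewrite filled_occupied unzip1_cat !unzip1_labelled.
  by have := occupied_infuse h xs ys [::] q; rewrite !cats0.
have vW : valid h (r.1 ++ r.2).
  by move: v; rewrite -[xs ++ ys]cats0 -catA valid_infuse cats0.
have FT q : filled h W q -> T1 q = filled h W q.
  by rewrite occE -(two_strips_dom q sT) /T1 /BK_filling => ->.
have T1other q : ~~ filled h W q -> T1 q = T q.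
  by rewrite occE -(two_strips_dom q sT) /T1 /BK_filling => /negbTE ->.
have Wl q j : has_letter j (filled h W q) -> (j == i) || (j == i.+1).
  exact: filled_letters.
have T1l q j : ~~ filled h W q -> has_letter j (T1 q) -> (j != i) && (j != i.+1).
  move=> nq; rewrite (T1other q nq) => Tj; move: nq; rewrite occE -(two_strips_dom q sT) negb_or.
  by case/andP=> n1 n2; apply/andP; split; apply/negP => /eqP jE;
    [move: n1|move: n2]; rewrite -jE Tj.
have canT1 : canonical_form la T1.
  apply/canonical_first => j x fx.
  have [Wx|nWx] := boolP (isSome (filled h W x)).
    apply: (primed_not_first sh vW _ FT Wx fx) => q.
    by have := occupied_infuse h xs ys [::] q; rewrite !cats0 => ->; apply: domW.
  have xj : has_letter j (T1 x).
    have := @mem_head _ x [::]; move: fx; rewrite /first_box.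
    set s := [seq _ <- _ | _]; have : all (fun x => has_letter j (T1 x)) s by apply: filter_all.
    by case: s => //= z s /andP[hz _] [<-].
  have /andP[j1 j2] := T1l _ _ nWx xj.
  have sameT q : has_letter j (T1 q) = has_letter j (T q).
    have [Wq|nq] := boolP (isSome (filled h W q)); last by rewrite T1other.
    rewrite FT //; apply/idP/idP => [/Wl|Tj].
      by rewrite (negbTE j1) (negbTE j2).
    move: Wq; rewrite occE -(two_strips_dom q sT).
    by case: (T q) Tj => //= l /eqP ->; rewrite (negbTE j1) (negbTE j2).
  rewrite T1other //; move/canonical_first: canT; apply.
  by rewrite -fx /first_box; congr ohead; apply: eq_filter => q; rewrite sameT.
have BKE : BK la i T = T1.
  rewrite /BK; suff -> : exchange_labels i (SP la i T) = T1 by apply: canonicalize_id.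
  have swE : switching la i i.+1 (part T i) (part T i.+1) =
      filled h (labelled i.+1 r.1 [::] ++ labelled i r.2 [::]).
    by rewrite /switching E.
  apply: funext => x; rewrite /exchange_labels /SP /T1 /BK_filling.
  rewrite -/r; case: ifP => [o|n]; last first.
    case: (T x) n => [[j p]|] //= /negbT; rewrite negb_or => /andP[n1 n2].
    by rewrite (negbTE n1) (negbTE n2).
  rewrite /SP1 /SP2 swE -filled_exchange /exchange_labels /union_filling /part.
  set S := filled h _; case Sx: (S x) => [[j p]|] //=.
  have := @Wl x; rewrite /W -filled_exchange /exchange_labels -/S Sx /= => Sl.
  have [jE|ji] := eqVneq j i.+1; first by rewrite jE eqxx.
  have [jE|ji'] := eqVneq j i; first by rewrite jE eqxx.
  by have := Sl j; rewrite (negbTE ji) (negbTE ji') eqxx => /(_ isT).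
split=> //.
- split=> // q; have [Wq _|nq] := boolP (isSome (filled h W q)).
    by apply: domW; rewrite -occE.
  by rewrite T1other //; apply: domT.
split=> //; apply: funext => q; rewrite -/W /union_filling /part.
have [Wq|nq] := boolP (isSome (filled h W q)).
  rewrite FT //; case Fq: (filled h W q) Wq => [l|] // _.
  have := @Wl q l.1; rewrite Fq /= eqxx => /(_ isT) /orP[] /eqP lE.
    by rewrite lE eqxx.
  by rewrite lE eqxx; case: ifP.
have := T1l q _ nq; case: (T1 q) => [l|] /=; last by case: (filled h W q) nq.
by move=> /(_ l.1 (eqxx _)) /andP[/negbTE -> /negbTE ->]; case: (filled h W q) nq.
Qed.

End BK.

Lemma BK_involutive la i T h xs ys : canonical_within la T -> two_strips h i xs ys T ->
  BK la i (BK la i T) = T.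
Proof.
move=> gT sT; have [-> gT1 sT1] := BK_two_strips gT sT.
have [-> _ _] := BK_two_strips gT1 sT1.
apply: funext => x; rewrite {1}/BK_filling infuseK /=.
rewrite (two_strips_dom x sT1).
have := occupied_infuse h xs ys [::] x; rewrite !cats0 => ->.
rewrite -(two_strips_dom x sT); case: ifP => [o|n]; last by rewrite /BK_filling n.
case: sT => _ _ _ _ <-; rewrite /union_filling /part.
by case: ifP o => [|_ /= ->] //; case: (T x).
Qed.

Lemma has_letter_other i j l : has_letter i l -> j != i -> has_letter j l = false.
Proof. by case: l => //= l /eqP ->; rewrite eq_sym => /negbTE. Qed.

Lemma BK_filling_other h i xs ys T k x : k != i -> k != i.+1 ->
  has_letter k (T x) || has_letter k (BK_filling h i xs ys T x) ->
  BK_filling h i xs ys T x = T x.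
Proof.
move=> ki ki'; rewrite /BK_filling; case: ifP => // /orP[] Ti; rewrite (has_letter_other Ti) //=.
  by move/filled_letters; rewrite (negbTE ki) (negbTE ki').
by move/filled_letters; rewrite (negbTE ki) (negbTE ki').
Qed.

Lemma has_BK_filling h i xs ys T k x : k != i -> k != i.+1 ->
  has_letter k (BK_filling h i xs ys T x) = has_letter k (T x).
Proof.
move=> ki ki'; apply/idP/idP => H.
  by rewrite -(@BK_filling_other h i xs ys T k x) // H orbT.
by rewrite (@BK_filling_other h i xs ys T k x) // H.
Qed.

Lemma part_BK_filling h i xs ys T k : k != i -> k != i.+1 ->
  part (BK_filling h i xs ys T) k = part T k.
Proof.
move=> ki ki'; apply: funext => x; rewrite /part has_BK_filling //.
by case: ifP => // H; rewrite (@BK_filling_other h i xs ys T k x) // H.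
Qed.

Lemma BK_commute la i j T h xs ys h' xs' ys' : canonical_within la T ->
  two_strips h i xs ys T -> two_strips h' j xs' ys' T ->
  i.+1 < j -> BK la i (BK la j T) = BK la j (BK la i T).
Proof.
move=> gT si sj ij.
have [ji ji' j'i j'i'] : [/\ j != i, j != i.+1, j.+1 != i & j.+1 != i.+1] by split; lia.
have [ij0 ij1 i'j i'j'] : [/\ i != j, i != j.+1, i.+1 != j & i.+1 != j.+1] by split; lia.
have [-> gI _] := BK_two_strips gT si; have [-> gJ _] := BK_two_strips gT sj.
have sj' : two_strips h' j xs' ys' (BK_filling h i xs ys T).
  by case: sj => *; split; rewrite ?part_BK_filling.
have si' : two_strips h i xs ys (BK_filling h' j xs' ys' T).
  by case: si => *; split; rewrite ?part_BK_filling.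
have [-> _ _] := BK_two_strips gI sj'; have [-> _ _] := BK_two_strips gJ si'.
apply: funext => x; rewrite {1 3}/BK_filling !has_BK_filling //.
rewrite {1}/BK_filling; case: ifP => [o|n].
  rewrite ifF; first by rewrite /BK_filling o.
  by case/orP: o => o; rewrite !(has_letter_other o).
by case: ifP => // o; rewrite /BK_filling ?n ?o.
Qed.

(** * Tableaux are pairs of strips *)

Lemma valid_split h xs :
  (forall u d w, xs = u ++ d :: w -> addable (grown h u) d) -> valid h xs.
Proof.
elim: xs h => //= d xs IH h ad; apply/andP; split; first exact: (ad [::] d xs).
by apply: IH => u e w E; apply: (ad (d :: u) e w); rewrite E.
Qed.

Lemma filled_graph h xs (f : nat -> letter) r d : uniq xs ->
  filled h [seq (c, f c) | c <- xs] (r, r + d) =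
  if (d \in xs) && (r == h d) then Some (f d) else None.
Proof.
elim: xs h => //= c xs IH h /andP[cxs uxs]; rewrite inE.
case: eqP => [[rE dE]|ne].
  have dc : d = c by apply/eqP; rewrite -(eqn_add2l r) dE rE.
  by rewrite dc rE !eqxx.
rewrite IH // /grow; case: (eqVneq d c) => [dE|dc] /=; last by rewrite addn0.
subst d; rewrite (negbTE cxs) /=; case: eqP => // rE.
by case: ne; rewrite rE.
Qed.

Lemma initial_segment (p : pred nat) N r : (forall r, p r.+1 -> p r) ->
  (forall r, p r -> r < N) -> p r = (r < find (predC p) (iota 0 N)).
Proof.
move=> dn bd; set m := find _ _.
have dn' s t : s <= t -> p t -> p s.
  elim: t => [|t IH]; first by rewrite leqn0 => /eqP ->.
  by rewrite leq_eqVlt => /orP[/eqP -> //|/IH st /dn].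
have mN : m <= N by rewrite -[X in _ <= X](size_iota 0) find_size.
apply/idP/idP => [pr|rm].
  rewrite ltnNge; apply/negP => mr; have pm := dn' _ _ mr pr; have mlt := bd _ pm.
  have : has (predC p) (iota 0 N) by rewrite has_find size_iota.
  by move/(nth_find 0); rewrite -/m nth_iota //= pm.
have := before_find 0 rm; rewrite nth_iota ?(leq_trans rm) //=.
by move/negbT; rewrite negbK.
Qed.

Lemma in_shape_left la r c : r <= c -> in_shape la (r, c.+1) -> in_shape la (r, c).
Proof. by rewrite /in_shape /=; lia. Qed.

Lemma in_shape_up la r c : strict_partition la ->
  in_shape la (r.+1, c) -> in_shape la (r, c).
Proof.
case/andP=> sl _; rewrite /in_shape /= => rc.
have rl : r.+1 < size la.
  by rewrite ltnNge; apply/negP => /(nth_default 0) E; move: rc; rewrite E; lia.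
have := sorted_ltn_nth (rev_trans ltn_trans) 0 sl r r.+1.
rewrite !inE => /(_ (ltnW rl) rl (ltnSn r)) /=; lia.
Qed.

Section Strips.
Variables (la mu : seq nat) (n : nat) (T : filling).
Hypotheses (sla : strict_partition la) (smu : strict_partition mu).
Hypothesis sub : subshape mu la.
Hypothesis tT : ShST la mu n T.

Lemma T_in x : isSome (T x) -> in_shape la x.
Proof. by rewrite (ShST_shape tT) => /andP[]. Qed.

Lemma T_some x : in_shape la x -> ~~ in_shape mu x -> exists l, T x = Some l.
Proof.
move=> xl xm; have := ShST_shape tT x; rewrite /in_skew xl xm.
by case: (T x) => // l _; exists l.
Qed.

Definition inner (k : nat) (x : box) : bool :=
  in_shape mu x || (if T x is Some l then l.1 < k else false).

Lemma inner_in k x : inner k x -> in_shape la x.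
Proof. by case/orP=> [/sub//|Tx]; apply: T_in; case: (T x) Tx. Qed.

Lemma lel_le l m : lel l m -> l.1 <= m.1.
Proof. by rewrite /lel; lia. Qed.

Lemma inner_left k r c : r <= c -> inner k (r, c.+1) -> inner k (r, c).
Proof.
move=> rc i; have xl := in_shape_left rc (inner_in i); rewrite /inner.
case: (boolP (in_shape mu (r, c))) => //= xm; have [l Tx] := T_some xl xm.
case/orP: i => [/(in_shape_left rc)|]; first by rewrite (negbTE xm).
rewrite Tx; case Ty: (T (r, c.+1)) => [m|] // mk.
by apply: leq_ltn_trans mk; apply: lel_le (ShST_row tT (leqnSn c) Tx Ty).
Qed.

Lemma inner_up k r c : inner k (r.+1, c) -> inner k (r, c).
Proof.
move=> i; have xl := in_shape_up sla (inner_in i); rewrite /inner.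
case: (boolP (in_shape mu (r, c))) => //= xm; have [l Tx] := T_some xl xm.
case/orP: i => [/(in_shape_up smu)|]; first by rewrite (negbTE xm).
rewrite Tx; case Ty: (T (r.+1, c)) => [m|] // mk.
by apply: leq_ltn_trans mk; apply: lel_le (ShST_col tT (leqnSn r) Tx Ty).
Qed.

Definition height (k d : nat) : nat :=
  find (predC (fun r => inner k (r, r + d))) (iota 0 (size la)).

Lemma inner_height k r d : inner k (r, r + d) = (r < height k d).
Proof.
apply: (initial_segment (p := fun r => inner k (r, r + d))) => [{}r|{}r].
  by rewrite addSn => /inner_up; apply: inner_left; rewrite leq_addr.
move/inner_in; rewrite /in_shape /= => rd.
by rewrite ltnNge; apply/negP => /(nth_default 0) E; move: rd; rewrite E; lia.
Qed.

Lemma profile_height k : profile (height k).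
Proof.
move=> d; apply/andP; split; rewrite leqNgt; apply/negP => lt.
  have : inner k (height k d, height k d + d.+1) by rewrite inner_height.
  by rewrite addnS => /inner_left; rewrite leq_addr inner_height ltnn => /(_ isT).
have : inner k ((height k d.+1).+1, (height k d.+1).+1 + d) by rewrite inner_height.
by rewrite addSnnS => /inner_up; rewrite inner_height ltnn.
Qed.

Lemma has_letter_height k r d :
  has_letter k (T (r, r + d)) = (height k d <= r < height k.+1 d).
Proof.
rewrite leqNgt -!inner_height /inner.
have := ShST_shape tT (r, r + d); case: (T _) => [l|] //=; last by rewrite !orbF andNb.
by rewrite /in_skew => /esym /andP[_ /negbTE ->] /=; lia.
Qed.

Section Letter.
Variable k : nat.
Let h := height k.
Let h' := height k.+1.

(** Two boxes with letter [k] on one diagonal leave no possible prime for the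
    box to the right of the upper one: primed, it would share its row with a
    primed box; unprimed, its column with an unprimed one. *)
Lemma height_step d : h d <= h' d <= (h d).+1.
Proof.
apply/andP; split; rewrite leqNgt; apply/negP => lt.
  have : inner k (h' d, h' d + d) by rewrite inner_height.
  have : ~~ inner k.+1 (h' d, h' d + d) by rewrite inner_height ltnn.
  rewrite /inner negb_or => /andP[/negbTE -> /=].
  by case: (T _) => // l; lia.
set r := h d in lt; have ll r' : h d <= r' < h' d -> exists p, T (r', r' + d) = Some (k, p).
  rewrite -has_letter_height; case: (T _) => // -[i p] /= /eqP ->; by exists p.
have [|p1 T1] := ll r; first by rewrite /r leqnn /=; lia.
have [|p2 T2] := ll r.+1; first by rewrite /r leqnSn.
have [q Tq] : exists l, T (r, (r + d).+1) = Some l.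
  apply: T_some; first by apply: in_shape_up sla (T_in _); rewrite -addSn T2.
  apply/negP => m; have : in_shape mu (r, r + d) by apply: in_shape_left m; rewrite leq_addr.
  by have := ShST_shape tT (r, r + d); rewrite T1 /= => /esym /andP[_ /negbTE ->].
have l1 := ShST_row tT (leqnSn _) T1 Tq.
have l2 := ShST_col tT (leqnSn _) Tq (T2 : T (r.+1, (r + d).+1) = _).
case: q Tq l1 l2 => i q Tq; rewrite /lel /= => l1 l2.
(* The box to the right of the upper one is squeezed between two letters [k]. *)
have ik : i = k by lia.
subst i; case: q Tq l1 l2 => Tq l1 l2.
  have p1t : p1 = true by move: l1; rewrite ltnn eqxx.
  by subst p1; have := ShST_primed tT T1 Tq; lia.
have p2f : p2 = false by move: l2; rewrite ltnn eqxx /= implybF => /negbTE.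
by subst p2; have := ShST_unprimed tT Tq (T2 : T (r.+1, (r + d).+1) = _); lia.
Qed.

Definition in_strip (d : nat) : bool := h d < h' d.
Definition primed (d : nat) : bool := T (cell h d) == Some (k, true).

Lemma T_strip d : in_strip d -> T (cell h d) = Some (k, primed d).
Proof.
move=> md; have : has_letter k (T (cell h d)).
  by rewrite /cell has_letter_height leqnn.
rewrite /primed; case: (T _) => // -[i p] /= /eqP ->.
by case: p; rewrite eqE /= eqE /= eqxx.
Qed.

Lemma strip_right d : in_strip d -> in_strip d.+1 -> h d.+1 = h d -> ~~ primed d.+1.
Proof.
move=> m m' e; apply/negP => p; have T1 := T_strip m; have T2 := T_strip m'.
rewrite /cell e addnS p in T1 T2.
have := ShST_row tT (leqnSn _) T1 T2; rewrite /lel /= ltnn eqxx /= => pd.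
by rewrite pd in T1; have := ShST_primed tT T1 T2; lia.
Qed.

Lemma strip_below d : in_strip d -> in_strip d.+1 -> h d = (h d.+1).+1 -> primed d.+1.
Proof.
move=> m m' e; apply: contraT => p; have T1 := T_strip m; have T2 := T_strip m'.
rewrite /cell e addSnnS (negbTE p) in T1 T2.
have := ShST_col tT (leqnSn _) T2 T1; rewrite /lel /= ltnn eqxx /= implybF => /negbTE pd.
by rewrite pd in T1; have := ShST_unprimed tT T2 T1; lia.
Qed.

(** The standard order of a strip. *)
Definition before (e d : nat) : bool :=
  if primed e then (if primed d then d < e else true)
  else ~~ primed d && (e < d).

Lemma before_trans : transitive before.
Proof.
move=> y x z; rewrite /before.
by case: (primed x); case: (primed y); case: (primed z) => //=; lia.
Qed.

Lemma before_total e d : [|| e == d, before e d | before d e].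
Proof.
rewrite /before; case: eqVneq => //= ed.
by case: (primed e); case: (primed d) => //=; lia.
Qed.

Lemma before_asym e d : before e d -> before d e = false.
Proof.
by rewrite /before; case: (primed e); case: (primed d) => //=; lia.
Qed.

Let le_before e d := (e == d) || before e d.

Definition strip : seq nat := sort le_before [seq d <- iota 0 (sumn la) | in_strip d].

Lemma strip_uniq : uniq strip.
Proof. by rewrite sort_uniq filter_uniq // iota_uniq. Qed.

Lemma mem_strip d : (d \in strip) = in_strip d.
Proof.
rewrite mem_sort mem_filter mem_iota /=; case: (boolP (in_strip d)) => //= m.
have /T_in : isSome (T (cell h d)) by rewrite T_strip.
rewrite /in_shape /cell /= => /andP[_]; rewrite ltn_add2l => /leq_trans; apply.
(* A row of [la] has at most [sumn la] boxes, which bounds its contents. *)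
case: (ltnP (h d) (size la)) => hs; last by rewrite nth_default.
rewrite -{2}(cat_take_drop (h d) la) sumn_cat (drop_nth 0 hs) /=; lia.
Qed.

Lemma strip_pairwise : pairwise before strip.
Proof.
have le_trans : transitive le_before.
  move=> y x z; rewrite /le_before => /orP[/eqP->//|xy] /orP[/eqP<-|yz]; first by rewrite xy orbT.
  by rewrite (before_trans xy yz) orbT.
have : sorted le_before strip.
  by apply: sort_sorted => x y; have := before_total x y; rewrite /le_before eq_sym; case: eqVneq.
rewrite (sorted_pairwise le_trans) => p; have := strip_uniq; rewrite uniq_pairwise => u.
have : pairwise (fun x y => le_before x y && (x != y)) strip by rewrite pairwise_relI p u.
by apply: sub_pairwise => x y /andP[/orP[/eqP->|//]]; rewrite eqxx.
Qed.

Lemma strip_split u d w : strip = u ++ d :: w ->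
  [/\ in_strip d, forall e, (e \in u) = in_strip e && before e d &
    forall e, (e \in w) = in_strip e && before d e].
Proof.
move=> E; have := strip_pairwise; rewrite E pairwise_cat /=.
case/and4P => /allrelP uw _ /allP dw _.
have uB e : e \in u -> before e d by move=> eu; apply: uw; rewrite ?mem_head.
have irr e : before e e = false.
  by apply/negP => b; move: (before_asym b); rewrite b.
split; first by rewrite -mem_strip E mem_cat mem_head orbT.
  move=> e; rewrite -mem_strip E mem_cat inE; apply/idP/idP => [eu|].
    by rewrite eu /=; apply: uB.
  case/andP=> /or3P[//|/eqP->|/dw/before_asym ->//]; by rewrite irr.
move=> e; rewrite -mem_strip E mem_cat inE; apply/idP/idP => [ew|].
  by rewrite ew !orbT /=; apply: dw.
case/andP=> /or3P[/uB/before_asym ->//|/eqP->|//]; by rewrite irr.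
Qed.

Lemma grown_strip : grown h strip = h'.
Proof.
apply: funext => d; rewrite grownE /cnt count_uniq_mem ?strip_uniq // mem_strip.
by have := height_step d; rewrite /in_strip; lia.
Qed.

(** Whether a neighbour of the box on the diagonal [d] comes before it in the
    standard order is decided by [strip_right] and [strip_below]. *)
Lemma strip_valid : valid h strip.
Proof.
apply: valid_split => u d w E; have [md uE _] := strip_split E.
have gE e : grown h u e = h e + (in_strip e && before e d).
  rewrite grownE /cnt count_uniq_mem ?uE //.
  by have := strip_uniq; rewrite E cat_uniq => /andP[].
have ndd : before d d = false by apply/negP => b; move: (before_asym b); rewrite b.
have ph := profile_height k; rewrite /addable !gE ndd andbF addn0; apply/andP; split; last first.
  have /andP[h1 h2] := ph d; rewrite -/h in h1 h2.
  have [e|ne] := eqVneq (h d.+1) (h d).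
    rewrite e; case: (boolP (in_strip d.+1)) => [m|_]; last by rewrite addn0.
    by rewrite /before (negbTE (strip_right md m e)) ltnNge leqnSn andbF addn0.
  have e : h d = (h d.+1).+1 by lia.
  have m : in_strip d.+1.
    have : inner k.+1 (h d, h d + d) by rewrite inner_height.
    by rewrite e addSnnS => /inner_up; rewrite inner_height.
  rewrite m /before (strip_below md m e) ltnSn e.
  by case: ifP => _; rewrite addn1.
case: d md {E uE ndd} gE => //= d md gE.
have /andP[h1 h2] := ph d; rewrite -/h in h1 h2.
have lt : h d.+1 < h' d.
  have : inner k.+1 (h d.+1, h d.+1 + d.+1) by rewrite inner_height.
  by rewrite addnS => /inner_left; rewrite leq_addr inner_height => /(_ isT).
have [e|ne] := eqVneq (h d.+1) (h d).
  have m : in_strip d by rewrite /in_strip -e.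
  rewrite m /before (negbTE (strip_right m md e)) ltnSn e.
  by case: ifP => _; rewrite addn1.
have e : h d = (h d.+1).+1 by lia.
case: (boolP (in_strip d)) => [m|_]; last by rewrite e addn0.
rewrite /before (strip_below m md e) e.
by case: ifP; rewrite ?ltnNge ?leqnSn /= addn0.
Qed.

(** In canonical form the first box of the strip that is read is unprimed, and
    in a strip a box that is read earlier has a smaller content. *)
Lemma strip_canonical d : in_strip d -> primed d ->
  exists z, [/\ in_strip z, ~~ primed z & z < d].
Proof.
move=> md pd; have Td := T_strip md; rewrite pd in Td.
have yl : cell h d \in reading_order la by rewrite mem_reading_order T_in ?Td.
have Py : has_letter k (T (cell h d)) by rewrite Td /=.
case fx: (first_box la T k) => [[r c]|]; last first.
  move: fx; rewrite /first_box; 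
  have : cell h d \in [seq x <- reading_order la | has_letter k (T x)].
    by rewrite mem_filter Py.
  by case: [seq _ <- _ | _].
have nT := (canonical_first la T).1 (ShST_canonical tT) _ _ fx.
have Tk : has_letter k (T (r, c)).
  move: fx; rewrite /first_box; set s := [seq _ <- _ | _].
  have : all (fun x => has_letter k (T x)) s by apply: filter_all.
  by case: s => //= z s /andP[hz _] [<-].
have rc : r <= c.
  by have /andP[] : in_shape la (r, c) by apply: T_in; case: (T _) Tk.
have cE : c = r + (c - r) by rewrite subnKC.
set z := c - r in cE.
have /andP[zr rz] : h z <= r < h' z by rewrite -has_letter_height -cE.
have hz : r = h z by have := height_step z; lia.
have mz : in_strip z by rewrite /in_strip -hz.
have xE : (r, c) = cell h z by rewrite /cell -hz -cE.
have pz : ~~ primed z by apply/negP => /eqP; rewrite -xE.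
exists z; split=> //; rewrite ltnNge leq_eqVlt negb_or; apply/andP; split.
  by apply: contra pz => /eqP <-.
apply/negP => dz; have le := shape_le (profile_height k) (ltnW dz); rewrite -/h in le.
have [E|] := ohead_filter_first (reading_order_pairwise la) fx yl Py.
  by move: dz; rewrite xE in E; have [-> _] := cell_inj E; rewrite ltnn.
by rewrite /read_before xE /=; lia.
Qed.

Lemma strip_vee_labelled :
  vee strip /\ labelled k strip [::] = [seq (d, (k, primed d)) | d <- strip].
Proof.
suff S w : forall u, strip = u ++ w ->
    vee w /\ labelled k w [::] = [seq (d, (k, primed d)) | d <- w].
  exact: (S strip [::]).
elim: w => //= d w IH u E.
have [vw ->] := IH (rcons u d) (etrans E (esym (cat_rcons _ _ _))).
have [md _ wE] := strip_split E; rewrite vw cats0.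
have pw : pairwise before (d :: w) by have := strip_pairwise; rewrite E pairwise_cat => /and3P[].
(* If [d] is primed, [strip_canonical] provides a smaller content, which can
   only come after [d]. *)
have dE : desc d w = primed d.
  case: (boolP (primed d)) => [pd|pd].
    have [z [mz pz zd]] := strip_canonical md pd.
    have zw : z \in w by rewrite wE mz /before pd (negbTE pz).
    case: w zw pw {IH E vw wE} => // c w; rewrite inE => zw /= /andP[/andP[dc _] /andP[/allP cw _]].
    move: dc; rewrite /before pd; case: (boolP (primed c)) => pc //= _.
    case/orP: zw => [/eqP <- //|/cw]; rewrite /before (negbTE pc) => /andP[_ cz].
    exact: ltn_trans zd.
  case: w pw {IH E vw wE} => // c w /= /andP[/andP[dc _] _].
  by move: dc; rewrite /before (negbTE pd) => /andP[_ dc]; lia.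
rewrite dE; split=> //; case: (boolP (primed d)) => //= pd.
rewrite path_pairwise; last exact: ltn_trans.
have : pairwise before (d :: w) by [].
move=> /= /andP[/allP dw pw']; apply/andP; split.
  by apply/allP => e /dw; rewrite /before (negbTE pd) => /andP[].
have : pairwise (fun x y => before x y && (~~ primed x)) w.
  rewrite pairwise_relI pw' /=.
  have : all (predC primed) w by apply/allP => e /dw; rewrite /before (negbTE pd) => /andP[].
  by elim: (w) => //= c v IHv /andP[pc /[dup] av /IHv ->]; rewrite andbT; apply/allP.
by apply: sub_pairwise => x y /andP[+ px]; rewrite /before (negbTE px) => /andP[].
Qed.

Lemma filled_strip : filled h (labelled k strip [::]) = part T k.
Proof.
have [_ ->] := strip_vee_labelled; apply: funext => -[r c]; rewrite /part.
case: (leqP r c) => rc; last first.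
  case Fx: (filled _ _ _) => [l|].
    have /filled_diag /= : isSome (filled h [seq (d, (k, primed d)) | d <- strip] (r, c)).
      by rewrite Fx.
    by rewrite leqNgt rc.
  case: ifP => // Tk; have := @T_in (r, c); rewrite /in_shape /=.
  by case: (T _) Tk => // l _ /(_ isT); lia.
rewrite -(subnKC rc) filled_graph ?strip_uniq // mem_strip has_letter_height.
have := height_step (c - r); rewrite -/h -/h' /in_strip; set d := c - r => hd.
case: eqP => [->|ne]; rewrite ?leqnn ?andbF /=.
  by rewrite andbT; case: ifP => // m; rewrite -(T_strip m).
by rewrite ifF //; apply/negP; lia.
Qed.

End Letter.

Lemma ShST_two_strips i : exists h xs ys, two_strips h i xs ys T.
Proof.
exists (height i), (strip i), (strip i.+1); split.
- exact: profile_height.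
- by have [] := strip_vee_labelled i.
- by have [] := strip_vee_labelled i.+1.
- by rewrite valid_cat grown_strip !strip_valid.
apply: funext => x; rewrite filled_cat unzip1_labelled grown_strip !filled_strip.
by [].
Qed.

Lemma ShST_canonical_within : canonical_within la T.
Proof. by split; [exact: T_in | exact: ShST_canonical tT]. Qed.

End Strips.

(** * Relations between the generators *)

Lemma BK_relation_invol k : BK_relation [:: k; k] [::].
Proof.
move=> la mu n T sla smu sub _ tT x /=.
have [h [xs [ys sT]]] := ShST_two_strips sla smu sub tT k.+1.
by rewrite (BK_involutive (ShST_canonical_within tT) sT).
Qed.

Lemma BK_relation_commute j k : j.+1 < k -> BK_relation [:: j; k] [:: k; j].
Proof.
move=> jk la mu n T sla smu sub _ tT x /=.
have [h [xs [ys sT]]] := ShST_two_strips sla smu sub tT j.+1.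
have [h' [xs' [ys' sT']]] := ShST_two_strips sla smu sub tT k.+1.
by rewrite (BK_commute (ShST_canonical_within tT) sT sT').
Qed.

Local Open Scope group_scope.

Lemma SBK_pi_mul (u v : word) :
  (\pi_SBK u)%qT * (\pi_SBK v)%qT = (\pi_SBK (u ++ v))%qT.
Proof. by apply/SBK_piP/SBK_cat; apply: SBK_reprK. Qed.

Lemma t_invol i : t_ i * t_ i = 1.
Proof.
case: i => [|k]; first exact: mulg1.
by rewrite SBK_pi_mul; apply/SBK_piP/(SBK_relation (@BK_relation_invol k)).
Qed.

Lemma t_commute i j : (i.+1 < j)%N -> commute (t_ i) (t_ j).
Proof.
case: i j => [|i] [|j] // ij; first by rewrite /commute mul1g mulg1.
rewrite /commute !SBK_pi_mul; apply/SBK_piP.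
exact: (SBK_relation (@BK_relation_commute i j ij)).
Qed.

Lemma t_inv i : (t_ i)^-1 = t_ i.
Proof. by apply: (mulgI (t_ i)); rewrite mulgV t_invol. Qed.

Lemma descent_commute i j : (i.+1 < j)%N -> commute (descent i) (t_ j).
Proof.
elim: i => [|i IH] ij; first by rewrite /commute mul1g mulg1.
by apply/commute_sym/commuteM; apply: commute_sym; [apply: t_commute | apply: IH; lia].
Qed.

Lemma q_commute i j : (i.+1 < j)%N -> commute (q_ i) (t_ j).
Proof.
elim: i => [|i IH] ij; first by rewrite /commute mul1g mulg1.
by apply/commute_sym/commuteM; apply: commute_sym; [apply: IH; lia | apply: descent_commute].
Qed.

Lemma descentS i : descent i.+1 = t_ i.+1 * descent i.
Proof. by []. Qed.

Lemma qS i : q_ i.+1 = q_ i * descent i.+1.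
Proof. by []. Qed.

Lemma t_one : t_ 1 = q_ 1.
Proof. by rewrite qS descentS mulg1 -[q_ 0]/(1 : SBK) mul1g. Qed.

(** The product defining [q_ i] may be written in the reverse order, because
    [t_ i.+2] commutes with [q_ i]. *)
Lemma q_rev i : q_ i.+1 = (descent i.+1)^-1 * q_ i.
Proof.
elim: i => [|i IH].
  by rewrite qS descentS mulg1 t_inv -[q_ 0]/(1 : SBK) mul1g mulg1.
rewrite qS {1}IH (descentS i.+1) (invgM (t_ i.+2)) t_inv -!mulgA; congr (_ * _).
by rewrite mulgA q_commute // -mulgA -qS.
Qed.

Lemma q_invol i : q_ i * q_ i = 1.
Proof.
elim: i => [|i IH]; first exact: mulg1.
by rewrite {1}q_rev qS -mulgA (mulgA (q_ i)) IH mul1g mulVg.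
Qed.

Lemma t_q i : t_ i.+2 = q_ i.+1 * q_ i.+2 * q_ i.+1 * q_ i.
Proof.
rewrite [q_ i.+2]qS (descentS i.+1).
move: (t_ i.+2) (descent i.+1) (q_ i.+1) (q_ i) (q_invol i.+1) (q_invol i) (q_rev i).
move=> t d q p qq pp qE.
by rewrite (mulgA q q) qq mul1g qE -!mulgA pp mulg1 mulgV mulg1.
Qed.

Local Open Scope classical_set_scope.

Lemma generated_closed (G : groupType) (A : set G) :
  group_closed [in generated A].
Proof.
split; first by rewrite inE => H [[H1 _] _]; rewrite inE in H1.
move=> x y; rewrite !inE => Ax Ay H [cH AH].
have := cH.2 x y; rewrite !inE; apply; [exact: Ax|exact: Ay].
Qed.

Lemma generated_sub (G : groupType) (A B : set G) :
  A `<=` generated B -> generated A `<=` generated B.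
Proof. exact: (smallest_sub (@generated_closed G B)). Qed.

Lemma in_generated (G : groupType) (A : set G) x : A x -> generated A x.
Proof. exact: sub_gen_smallest. Qed.

Lemma generatedM (G : groupType) (A : set G) x y :
  generated A x -> generated A y -> generated A (x * y).
Proof.
move=> Ax Ay; have := group_closedM (@generated_closed G A) (x := x) (y := y).
by rewrite !inE; apply.
Qed.

Lemma generated1 (G : groupType) (A : set G) : generated A 1.
Proof. by have [] := @generated_closed G A; rewrite inE. Qed.

Lemma generated_q n :
  generated [set q_ i | i in [set i : nat | 1 <= i < n]%N] = SBK_sub n.
Proof.
apply/seteqP; split; apply: generated_sub => _ [i /andP[i0 ilt] <-].
  have tG j : (j < n)%N -> SBK_sub n (t_ j).
    case: j => [_|j jn]; first exact: generated1.
    by apply: in_generated; exists j.+1.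
  have dG j : (j < n)%N -> SBK_sub n (descent j).
    elim: j => [_|j IH jn]; first exact: generated1.
    by rewrite descentS; apply: generatedM; [exact: tG | exact: IH (ltnW jn)].
  elim: i ilt {i0} => [_|i IH jn]; first exact: generated1.
  by rewrite qS; apply: generatedM; [exact: IH (ltnW jn) | exact: dG].
set Q := generated _; have qG j : (j < n)%N -> Q (q_ j).
  case: j => [_|j jn]; first exact: generated1.
  by apply: in_generated; exists j.+1.
case: i i0 ilt => [|[|i]] // _ ilt.
  by rewrite t_one; apply: qG.
have [i0n i1n] : (i < n)%N /\ (i.+1 < n)%N by lia.
rewrite t_q; apply: generatedM; last exact: qG.
apply: generatedM; last exact: qG.
by apply: generatedM; apply: qG.
Qed.

Theorem proposition4p24 :
  [/\ t_ 1 = q_ 1,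
      forall i : nat, (2 <= i)%N ->
        t_ i = q_ i.-1 * q_ i * q_ i.-1 * q_ i.-2
    & forall n : nat,
        generated [set q_ i | i in [set i : nat | 1 <= i < n]%N] = SBK_sub n].
Proof.
split; [| | exact: generated_q].
  exact: t_one.
by move=> [|[|i]] // _; apply: t_q.
Qed.
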